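(* Let $\varphi_\lambda:\mathbb{R}^n\times\mathbb{R}\to\mathbb{R}^n$, $\lambda\in[0,1]$, be a (continuous) parametrized family of dissipative flows. Let $K_0$ be the global attractor of $\varphi_0$ and let $K_\lambda$ denote a continuation of $K_0$. (1) If the family $\varphi_\lambda$ is coercive, then there exists $\lambda_0>0$ such that for every $\lambda$ with $0<\lambda<\lambda_0$ there is an isolated invariant compactum $C_\lambda$ (for $\varphi_\lambda$) in $\mathbb{R}^n\setminus K_\lambda$ such that: i) $C_\lambda$ separates $\mathbb{R}^n$ into two components and $K_\lambda$ lies in the bounded component; ii) $C_\lambda$ has the shape of $S^{n-1}$; iii) $C_\lambda$ attracts uniformly all the points of the unbounded component of $\mathbb{R}^n\setminus C_\lambda$ and repels all the points of the bounded one which are not in $K_\lambda$; iv) $\operatorname{diam}(C_\lambda)\to\infty$ when $\lambda\to0$, where $\operatorname{diam}(C_\lambda)$ denotes the diameter of $C_\lambda$. (2) Moreover, the existence of such a $C_\lambda$ for $0<\lambda<\lambda_0$ (that is, for some $\lambda_0>0$ and every $0<\lambda<\lambda_0$, an isolated invariant compactum $C_\lambda\subset\mathbb{R}^n\setminus K_\lambda$ for $\varphi_\lambda$ with properties i)--iv)) is sufficient for the family to be coercive.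
   Context: Throughout, the phase space is $M=\mathbb{R}^n$. A parametrized family of flows $\varphi_\lambda$, $\lambda\in[0,1]$, on $M$ is assumed continuous: $(x,t,\lambda)\mapsto\varphi_\lambda(x,t)$ is continuous. For a flow write $xt=\varphi(x,t)$, $xI=\varphi(\{x\}\times I)$ and $UI=\varphi(U\times I)$. The omega-limit of $x$ is $\omega(x)=\bigcap_{t>0}\overline{x[t,\infty)}$ and the negative omega-limit is $\omega^*(x)=\bigcap_{t<0}\overline{x(-\infty,t]}$. A subscript $\lambda$ (as in $\omega_\lambda$, $\omega^*_\lambda$, $\mathcal{A}_\lambda$) means with respect to $\varphi_\lambda$. Dissipative: a flow is dissipative if $\omega(x)\neq\emptyset$ for each $x\in M$ and the closure of $\bigcup_{x\in M}\omega(x)$ is compact. Attractors: a compact invariant set $K$ is stable if every neighborhood $U$ of $K$ contains a neighborhood $V$ of $K$ with $V[0,\infty)\subset U$; it is attracting if there is a neighborhood $U$ of $K$ with $\emptyset\neq\omega(x)\subset K$ for every $x\in U$. An attractor is a compact invariant set that is both attracting and stable. Its region of attraction is $\mathcal{A}(K)=\{x\in M:\emptyset\neq\omega(x)\subset K\}$. $K$ is a global attractor if it is an attractor with $\mathcal{A}(K)=M$. (A flow is dissipative if and only if it has a global attractor.) A set $C$ attracts a point $x$ uniformly if for every neighborhood $V$ of $C$ there are a neighborhood $U$ of $x$ and $T>0$ with $U[T,\infty)\subset V$. A set $C$ repels a point $x$ if $\emptyset\neq\omega^*(x)\subset C$. Isolated invariant sets and continuation: a compact invariant set $K$ is isolated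 if it has an isolating neighborhood, i.e. a compact neighborhood $N$ of $K$ such that $K$ is the maximal invariant set in $N$. Let $J\subset[0,1]$ be a closed non-degenerate subinterval and, for each $\lambda\in J$, let $K_\lambda$ be an isolated invariant set for $\varphi_\lambda$. The family $(K_\lambda)_{\lambda\in J}$ is a continuation if for each $\lambda_0\in J$ and each isolating neighborhood $N_{\lambda_0}$ of $K_{\lambda_0}$ (for $\varphi_{\lambda_0}$) there is $\delta>0$ such that $N_{\lambda_0}$ is an isolating neighborhood of $K_\lambda$ (for $\varphi_\lambda$) for every $\lambda\in(\lambda_0-\delta,\lambda_0+\delta)\cap J$. It is then called a continuation of $K_{\lambda_0}$ for each $\lambda_0\in J$. For a continuation of $K_0$ one has $0\in J$. If $K_0$ is a global attractor, then $K_\lambda$ is an attractor of $\varphi_\lambda$ for all sufficiently small $\lambda$. Statements about $K_\lambda$ for $0<\lambda<\lambda_0$ presuppose that $\lambda_0$ is small enough that these $\lambda$ lie in $J$. Coercive: a parametrized family of dissipative flows $\varphi_\lambda$ is coercive if for any continuation $K_\lambda$ of the global attractor $K_0$ of $\varphi_0$ there exists $\lambda_0>0$ such that $\mathcal{A}_\lambda(K_\lambda)$ is bounded for every $0<\lambda<\lambda_0$. ''Shape'' is in the sense of Borsuk's shape theory; $S^{n-1}$ is the unit sphere in $\mathbb{R}^n$.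
   Formalization: Part (1) is stated only for n ≥ 2: for n = 1 the complement of a compactum in R has two unbounded components, and for n = 0 nothing separates a point, so property i) fails for every coercive family. Part (2) is stated for all n. *)

(* Defs.v *)
From HB Require Import structures.
From mathcomp Require Import all_boot all_order all_algebra.
From mathcomp Require Import all_classical all_reals all_analysis.

Set Implicit Arguments.
Unset Strict Implicit.
Unset Printing Implicit Defensive.

Import Order.TTheory GRing.Theory Num.Theory.
Import numFieldNormedType.Exports.

Local Open Scope classical_set_scope.
Local Open Scope ring_scope.

(* The library norm on 'rV[R]_n is the sup norm; the sphere and the diameter
   below are Euclidean. *)
Definition euclid_dist (R : realType) (n : nat) (x y : 'rV[R]_n) : R :=
  Num.sqrt (\sum_(i < n) (x ord0 i - y ord0 i) ^+ 2).

Definition unit_sphere (R : realType) (n : nat) : set 'rV[R]_n :=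
  [set x | euclid_dist x 0 = 1].

Definition diam (R : realType) (n : nat) (A : set 'rV[R]_n) : \bar R :=
  ereal_sup [set (euclid_dist p.1 p.2)%:E | p in A `*` A].

(* Flows: the arguments of f are the point and then the time. *)

Definition is_flow (R : realType) (n : nat) (f : 'rV[R]_n -> R -> 'rV[R]_n) :
    Prop :=
  [/\ continuous (fun p : 'rV[R]_n * R => f p.1 p.2),
      (forall x, f x 0 = x)
    & (forall x s t, f (f x s) t = f x (s + t))].

Definition omega_limit (R : realType) (n : nat)
    (f : 'rV[R]_n -> R -> 'rV[R]_n) (x : 'rV[R]_n) : set 'rV[R]_n :=
  \bigcap_(t in [set t : R | 0 < t]) closure (f x @` [set s : R | t <= s]).

Definition neg_omega_limit (R : realType) (n : nat)
    (f : 'rV[R]_n -> R -> 'rV[R]_n) (x : 'rV[R]_n) : set 'rV[R]_n :=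
  \bigcap_(t in [set t : R | t < 0]) closure (f x @` [set s : R | s <= t]).

Definition dissipative (R : realType) (n : nat)
    (f : 'rV[R]_n -> R -> 'rV[R]_n) : Prop :=
  (forall x, omega_limit f x !=set0) /\
  compact (closure (\bigcup_x omega_limit f x)).

Definition invariant (R : realType) (n : nat)
    (f : 'rV[R]_n -> R -> 'rV[R]_n) (A : set 'rV[R]_n) : Prop :=
  forall x t, A x -> A (f x t).

Definition stable (R : realType) (n : nat)
    (f : 'rV[R]_n -> R -> 'rV[R]_n) (K : set 'rV[R]_n) : Prop :=
  forall U, set_nbhs K U ->
    exists2 V, set_nbhs K V & forall x t, V x -> 0 <= t -> U (f x t).

Definition region_of_attraction (R : realType) (n : nat)
    (f : 'rV[R]_n -> R -> 'rV[R]_n) (K : set 'rV[R]_n) : set 'rV[R]_n :=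
  [set x | omega_limit f x !=set0 /\ omega_limit f x `<=` K].

Definition attracting (R : realType) (n : nat)
    (f : 'rV[R]_n -> R -> 'rV[R]_n) (K : set 'rV[R]_n) : Prop :=
  exists2 U, set_nbhs K U & U `<=` region_of_attraction f K.

Definition attractor (R : realType) (n : nat)
    (f : 'rV[R]_n -> R -> 'rV[R]_n) (K : set 'rV[R]_n) : Prop :=
  [/\ compact K, invariant f K, attracting f K & stable f K].

Definition global_attractor (R : realType) (n : nat)
    (f : 'rV[R]_n -> R -> 'rV[R]_n) (K : set 'rV[R]_n) : Prop :=
  attractor f K /\ region_of_attraction f K = setT.

Definition attracts_uniformly (R : realType) (n : nat)
    (f : 'rV[R]_n -> R -> 'rV[R]_n) (C : set 'rV[R]_n) (x : 'rV[R]_n) : Prop :=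
  forall V, set_nbhs C V ->
    exists U (T : R), [/\ nbhs x U, 0 < T
      & forall y t, U y -> T <= t -> V (f y t)].

Definition repels (R : realType) (n : nat)
    (f : 'rV[R]_n -> R -> 'rV[R]_n) (C : set 'rV[R]_n) (x : 'rV[R]_n) : Prop :=
  neg_omega_limit f x !=set0 /\ neg_omega_limit f x `<=` C.

Definition isolating_nbhd (R : realType) (n : nat)
    (f : 'rV[R]_n -> R -> 'rV[R]_n) (K N : set 'rV[R]_n) : Prop :=
  [/\ compact N, set_nbhs K N, invariant f K
    & forall L, invariant f L -> L `<=` N -> L `<=` K].

Definition isolated_invariant (R : realType) (n : nat)
    (f : 'rV[R]_n -> R -> 'rV[R]_n) (K : set 'rV[R]_n) : Prop :=
  [/\ compact K, invariant f K & exists N, isolating_nbhd f K N].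

(* Parametrized families: the first argument of phi is the parameter; only its
   values in [0, 1] are constrained. *)

Definition flow_family (R : realType) (n : nat)
    (phi : R -> 'rV[R]_n -> R -> 'rV[R]_n) : Prop :=
  {within [set p : 'rV[R]_n * R * R | 0 <= p.2 <= 1],
     continuous (fun p : 'rV[R]_n * R * R => phi p.2 p.1.1 p.1.2)} /\
  (forall l : R, 0 <= l <= 1 -> is_flow (phi l)).

Definition dissipative_family (R : realType) (n : nat)
    (phi : R -> 'rV[R]_n -> R -> 'rV[R]_n) : Prop :=
  flow_family phi /\ (forall l : R, 0 <= l <= 1 -> dissipative (phi l)).

Definition parameter_interval (R : realType) (J : set R) : Prop :=
  exists a b : R, [/\ 0 <= a, a < b, b <= 1 & J = [set l | a <= l <= b]].

Definition continuation (R : realType) (n : nat)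
    (phi : R -> 'rV[R]_n -> R -> 'rV[R]_n)
    (J : set R) (K : R -> set 'rV[R]_n) : Prop :=
  [/\ parameter_interval J,
      (forall l, J l -> isolated_invariant (phi l) (K l))
    & forall l0 N, J l0 -> isolating_nbhd (phi l0) (K l0) N ->
        exists2 d : R, 0 < d &
          forall l, J l -> l0 - d < l < l0 + d -> isolating_nbhd (phi l) (K l) N].

Definition attractor_continuation (R : realType) (n : nat)
    (phi : R -> 'rV[R]_n -> R -> 'rV[R]_n)
    (J : set R) (K : R -> set 'rV[R]_n) : Prop :=
  [/\ continuation phi J K, J 0 & global_attractor (phi 0) (K 0)].

Definition coercive (R : realType) (n : nat)
    (phi : R -> 'rV[R]_n -> R -> 'rV[R]_n) : Prop :=
  forall J K, attractor_continuation phi J K ->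
    exists2 l0 : R, 0 < l0 &
      forall l, 0 < l < l0 ->
        J l /\ bounded_set (region_of_attraction (phi l) (K l)).

(* Borsuk's shape theory for compacta in R^n.  Since R^n is an absolute retract
   for metric spaces, fundamental sequences may be taken between the ambient
   copies of R^n: the resulting shape relation does not depend on the absolute
   retracts in which the compacta are embedded. *)

Definition homotopic_in (R : realType) (n : nat) (U V : set 'rV[R]_n)
    (f g : 'rV[R]_n -> 'rV[R]_n) : Prop :=
  exists h : 'rV[R]_n * R -> 'rV[R]_n,
    [/\ {within [set p | U p.1 /\ 0 <= p.2 <= 1], continuous h},
        (forall x, U x -> h (x, 0) = f x),
        (forall x, U x -> h (x, 1) = g x)
      & forall x t, U x -> 0 <= t <= 1 -> V (h (x, t))].

Definition fundamental_sequence (R : realType) (n : nat) (X Y : set 'rV[R]_n)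
    (f : nat -> 'rV[R]_n -> 'rV[R]_n) : Prop :=
  (forall k, continuous (f k)) /\
  (forall V, set_nbhs Y V -> exists2 U, set_nbhs X U &
     \forall k \near \oo, homotopic_in U V (f k) (f k.+1)).

Definition fundamental_homotopic (R : realType) (n : nat) (X Y : set 'rV[R]_n)
    (f g : nat -> 'rV[R]_n -> 'rV[R]_n) : Prop :=
  forall V, set_nbhs Y V -> exists2 U, set_nbhs X U &
    \forall k \near \oo, homotopic_in U V (f k) (g k).

Definition same_shape (R : realType) (n : nat) (X Y : set 'rV[R]_n) : Prop :=
  exists f g : nat -> 'rV[R]_n -> 'rV[R]_n,
    [/\ fundamental_sequence X Y f, fundamental_sequence Y X g,
        fundamental_homotopic X X (fun k => g k \o f k) (fun=> id)
      & fundamental_homotopic Y Y (fun k => f k \o g k) (fun=> id)].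

(* B and W are the two components of the complement of C, W being the
   unbounded one. *)
Definition separates_into (R : realType) (n : nat) (C B W : set 'rV[R]_n) :
    Prop :=
  [/\ [set connected_component (~` C) x | x in ~` C] = [set B; W],
      bounded_set B & ~ bounded_set W].

Definition separating_compactum (R : realType) (n : nat)
    (f : 'rV[R]_n -> R -> 'rV[R]_n) (K C : set 'rV[R]_n) : Prop :=
  [/\ isolated_invariant f C, C `<=` ~` K, same_shape C (@unit_sphere R n)
    & exists B W, [/\ separates_into C B W, K `<=` B,
        (forall x, W x -> attracts_uniformly f C x)
      & (forall x, B x -> ~ K x -> repels f C x)]].

Definition separating_family (R : realType) (n : nat)
    (phi : R -> 'rV[R]_n -> R -> 'rV[R]_n) (J : set R)
    (K C : R -> set 'rV[R]_n) (l0 : R) : Prop :=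
  (forall l, 0 < l < l0 -> J l /\ separating_compactum (phi l) (K l) (C l)) /\
  diam (C l) @[l --> (0 : R)^'+] --> +oo%E.

(* Main.v *)
Require Import Defs.
From HB Require Import structures.
From mathcomp Require Import all_boot all_order all_algebra.
From mathcomp Require Import all_classical all_reals all_analysis.
From mathcomp Require Import ring lra.

(** Write [G] for the set of points with bounded orbit.  For a dissipative flow
    [G] is compact and attracts every ball uniformly, and it is the only
    possible global attractor.

    A large ball around [K 0] is an isolating neighbourhood of [K 0] and is sent
    into its own interior by the flow at parameter 0 during a whole time window
    [[T, 2 T]].  Both facts persist for small [l] ([continuation_traps]), so this
    ball isolates [K l], is eventually trapped in its interior, and hence lies in
    the basin [A] of [K l].  The radius of the ball is arbitrary, provided that
    [l] is small enough.

    If [A] is bounded, it is an open invariant subset of [G], and the separating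
    compactum is the dual repeller [C], that is, [G] minus [A].
    - The complement of [C] is the disjoint union of [A] and of the complement of
      [G].  The first is connected as a union of backward images of a ball, all
      containing the origin; the second because its orbits all escape to the
      complement of a large ball, which is connected in dimension at least two.
    - A neighbourhood of [C] together with [A] is a neighbourhood of [G], and
      orbits outside [A] never enter it: this is attraction
      ([dual_repeller_attract]).  A backward limit point in [A] would confine the
      orbit to the trapped ball, which isolates [K l]: this is repulsion.
    - [A] contains a ball of large radius and is bounded, so its boundary, which
      lies in [C], has a large diameter.
    - For the shape, the maps from [C] to the sphere are the radial projection,
      and the [k]-th map from the sphere to [C] pushes a large sphere, which
      avoids [G], along the flow up to time [k].  The composite on the sphere is
      deformed to the identity by following the flow back.  For the composite on
      [C], a prescribed neighbourhood of [C] contains a shell, namely the image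
      of a large ball at a late time [k1] minus the image of a small open ball at
      time [- k2].  Transporting radial retractions by the flow gives a
      retraction [to_shell] of the space minus one point of [A] onto this shell;
      composing it with homotopies that avoid that point keeps them in the
      shell.

    Conversely, if a separating compactum exists, the points outside the bounded
    component have their omega-limit in it, so the basin of [K l] lies in that
    component; and any two continuations of the global attractor agree for small
    parameters. *)

Set Implicit Arguments.
Unset Strict Implicit.
Unset Printing Implicit Defensive.

Import Order.TTheory GRing.Theory Num.Theory.
Import numFieldNormedType.Exports.

Local Open Scope classical_set_scope.
Local Open Scope ring_scope.
(** * Balls of the sup norm *)

Section norm_topology.
Variables (R : realType) (n : nat).
Implicit Types (x : 'rV[R]_n) (T : topologicalType).

Lemma norm_comp_continuous T (g : T -> 'rV[R]_n) :
  continuous g -> continuous (fun z => `|g z|).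
Proof. by move=> cg z; apply: cvg_norm; exact: cg. Qed.

Lemma open_norm_lt T (g : T -> 'rV[R]_n) (a : R) :
  continuous g -> open [set z | `|g z| < a].
Proof.
move=> cg; apply: (@open_comp _ _ (fun z => `|g z|) [set u | u < a]).
  by move=> z _; exact: norm_comp_continuous.
exact: open_lt.
Qed.

Lemma open_norm_gt T (g : T -> 'rV[R]_n) (a : R) :
  continuous g -> open [set z | a < `|g z|].
Proof.
move=> cg; apply: (@open_comp _ _ (fun z => `|g z|) [set u | a < u]).
  by move=> z _; exact: norm_comp_continuous.
exact: open_gt.
Qed.

Lemma closed_norm_le (a : R) : closed [set x : 'rV[R]_n | `|x| <= a].
Proof.
rewrite [X in closed X](_ : _ = ~` [set x : 'rV[R]_n | a < `|x|]).
  by apply: open_closedC; apply: (@open_norm_gt _ id) => ?; exact: cvg_id.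
by apply/seteqP; split => x /= H; [apply/negP; rewrite -leNgt|rewrite leNgt; apply/negP].
Qed.

Lemma closed_norm_ge (a : R) : closed [set x : 'rV[R]_n | a <= `|x|].
Proof.
rewrite [X in closed X](_ : _ = ~` [set x : 'rV[R]_n | `|x| < a]).
  by apply: open_closedC; apply: (@open_norm_lt _ id) => ?; exact: cvg_id.
by apply/seteqP; split => x /= H; [apply/negP; rewrite -leNgt|rewrite leNgt; apply/negP].
Qed.

Lemma bounded_setP (A : set 'rV[R]_n) :
  bounded_set A <-> exists M : R, forall x, A x -> `|x| <= M.
Proof.
split=> [[M [Mr HM]]|[M HM]].
  by exists (M + 1) => x Ax; apply: (HM (M + 1)) => //; rewrite ltrDl.
exists M; split; first exact: num_real.
by move=> M' MM' x /HM /le_trans; apply; exact: ltW.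
Qed.

Lemma compact_norm_le (A : set 'rV[R]_n) :
  compact A -> exists M : R, forall x, A x -> `|x| <= M.
Proof. by move/compact_bounded/bounded_setP. Qed.

Lemma norm_le_compact (a : R) : compact [set x : 'rV[R]_n | `|x| <= a].
Proof.
by apply: bounded_closed_compact; [apply/bounded_setP; exists a|exact: closed_norm_le].
Qed.

Lemma rV_compact_closed (A : set 'rV[R]_n) : compact A -> closed A.
Proof. by apply: compact_closed; exact: norm_hausdorff. Qed.

Lemma open_set_nbhs (A V : set 'rV[R]_n) : open V -> A `<=` V -> set_nbhs A V.
Proof. by move=> oV AV; apply/set_nbhsP; exists V; split. Qed.

End norm_topology.

(** * Flows and limit sets *)

Section flows.
Variables (R : realType) (n : nat) (f : 'rV[R]_n -> R -> 'rV[R]_n).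
Hypothesis f_flow : is_flow f.
Implicit Types (x y : 'rV[R]_n) (s t : R).

Lemma flow_continuous : continuous (fun p : 'rV[R]_n * R => f p.1 p.2).
Proof. by case: f_flow. Qed.

Lemma flow0 x : f x 0 = x.
Proof. by case: f_flow. Qed.

Lemma flowD x s t : f (f x s) t = f x (s + t).
Proof. by case: f_flow. Qed.

Lemma flowK x t : f (f x t) (- t) = x.
Proof. by rewrite flowD subrr flow0. Qed.

Lemma flowNK x t : f (f x (- t)) t = x.
Proof. by rewrite flowD addNr flow0. Qed.

Lemma flow_cvg (T : Type) (F : set_system T) {FF : Filter F}
    (u : T -> 'rV[R]_n) (v : T -> R) x t :
  u z @[z --> F] --> x -> v z @[z --> F] --> t ->
  f (u z) (v z) @[z --> F] --> f x t.
Proof.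
move=> ux vt; apply: (@continuous2_cvg _ _ _ _ F FF u v f) => //.
exact: (@flow_continuous (x, t)).
Qed.

Lemma flow_continuousl t : continuous (f ^~ t).
Proof.
move=> x; apply: (@flow_cvg _ (nbhs x) _ id (fun=> t)); first exact: cvg_id.
exact: cvg_cst.
Qed.

Lemma flow_continuousr x : continuous (f x).
Proof.
move=> t; apply: (@flow_cvg _ (nbhs t) _ (fun=> x) id); first exact: cvg_cst.
exact: cvg_id.
Qed.

Lemma omega_limitP x y :
  omega_limit f x y <->
  forall V, nbhs y V -> forall T : R, exists2 t, T <= t & V (f x t).
Proof.
split=> [xy V yV T|xy t _ V yV].
  have T0 : 0 < Num.max T 1 by rewrite lt_max ltr01 orbT.
  have [_ [[t /= Tt <-] Vt]] := xy _ T0 _ yV.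
  by exists t => //; apply: le_trans Tt; rewrite le_max lexx.
have [s ts Vs] := xy _ yV t.
by exists (f x s); split => //; exists s.
Qed.

Lemma neg_omega_limitP x y :
  neg_omega_limit f x y <->
  forall V, nbhs y V -> forall T : R, exists2 t, t <= T & V (f x t).
Proof.
split=> [xy V yV T|xy t _ V yV].
  have T0 : Num.min T (- 1) < 0 by rewrite gt_min ltrN10 orbT.
  have [_ [[t /= Tt <-] Vt]] := xy _ T0 _ yV.
  by exists t => //; apply: (le_trans Tt); rewrite ge_min lexx.
have [s ts Vs] := xy _ yV t.
by exists (f x s); split => //; exists s.
Qed.

Lemma omega_limit_invariant x : Defs.invariant f (omega_limit f x).
Proof.
move=> y s /omega_limitP xy; apply/omega_limitP => V yV T.
have [t Tt Vt] := xy _ (flow_continuousl yV) (T - s).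
by exists (t + s); [rewrite -lerBlDr|rewrite -flowD].
Qed.

Lemma omega_limit_flow x s : omega_limit f (f x s) `<=` omega_limit f x.
Proof.
move=> y /omega_limitP xy; apply/omega_limitP => V yV T.
have [t Tt Vt] := xy _ yV (T - s).
by exists (s + t); [rewrite -lerBlDl|rewrite -flowD].
Qed.

Lemma region_of_attraction_invariant K : Defs.invariant f (region_of_attraction f K).
Proof.
move=> x s [[y xy] xK]; split.
  by exists y; apply: (@omega_limit_flow _ (- s)); rewrite flowK.
by move=> z /omega_limit_flow; exact: xK.
Qed.

Lemma omega_limit_closed x (Q : set 'rV[R]_n) (T : R) :
  closed Q -> (forall t, T <= t -> Q (f x t)) -> omega_limit f x `<=` Q.
Proof.
move=> cQ xQ y /omega_limitP xy; apply: cQ => V yV.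
by have [t Tt Vt] := xy _ yV T; exists (f x t); split => //; exact: xQ.
Qed.

Lemma omega_limit_nonempty x (Q : set 'rV[R]_n) (T : R) :
  compact Q -> (forall t, T <= t -> Q (f x t)) -> omega_limit f x !=set0.
Proof.
move=> cQ xQ.
have FQ : (f x @ +oo) Q by exists T; split; [exact: num_real|move=> t /ltW/xQ].
have [y [_ cy]] := cQ _ _ FQ.
exists y; apply/omega_limitP => V yV T'.
have [|_ [[t /= T't <-] Vt]] := cy [set f x t | t in [set t | T' <= t]] V _ yV.
  by exists T'; split; [exact: num_real|move=> t /ltW T't; exists t].
by exists t.
Qed.

End flows.

Lemma neg_omega_limit_nonempty (R : realType) (n : nat)
    (f : 'rV[R]_n -> R -> 'rV[R]_n) (x : 'rV[R]_n) (Q : set 'rV[R]_n) :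
  compact Q -> (forall t, Q (f x t)) ->
  neg_omega_limit f x !=set0.
Proof.
move=> cQ xQ.
have [y /omega_limitP xy] : omega_limit (fun x t => f x (- t)) x !=set0.
  by apply: (@omega_limit_nonempty _ _ _ _ Q 0) => // t _; exact: xQ.
exists y; apply/neg_omega_limitP => V yV T.
have [t Tt Vt] := xy _ yV (- T); exists (- t) => //.
by rewrite lerNl.
Qed.

(** * The global attractor of a dissipative flow *)

Definition bounded_orbits (R : realType) (n : nat)
    (f : 'rV[R]_n -> R -> 'rV[R]_n) : set 'rV[R]_n :=
  [set x | exists M : R, forall t, `|f x t| <= M].

Section bounded_orbits.
Variables (R : realType) (n : nat) (f : 'rV[R]_n -> R -> 'rV[R]_n).
Hypothesis f_flow : is_flow f.
Implicit Types (x y : 'rV[R]_n) (s t : R).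

Lemma bounded_orbits_invariant : Defs.invariant f (bounded_orbits f).
Proof. by move=> x s [M xM]; exists M => t; rewrite flowD. Qed.

Lemma bounded_invariant_sub (L : set 'rV[R]_n) :
  Defs.invariant f L -> bounded_set L -> L `<=` bounded_orbits f.
Proof. by move=> iL /bounded_setP[M LM] x Lx; exists M => t; apply/LM/iL. Qed.

(** Stability makes a global attractor maximal.  A bounded orbit has a backward
    limit point, and the forward orbit of that point approaches [A]; hence in the
    past the orbit has been as close to [A] as one likes, and stability keeps it
    close up to time [0]. *)
Lemma global_attractor_bounded_orbits (A : set 'rV[R]_n) :
  global_attractor f A -> A = bounded_orbits f.
Proof.
move=> [[cA iA _ sA] Aall]; apply/seteqP; split=> [|x [M xM]].
  by apply: bounded_invariant_sub => //; exact: compact_bounded.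
apply: (rV_compact_closed cA) => W xW.
have [e /= e0 eW] := (nbhs_ballP x W).1 xW.
pose U := \bigcup_(a in A) ball a e.
have AU : set_nbhs A U.
  apply: open_set_nbhs; last by move=> a Aa; exists a => //; exact: ballxx.
  by apply: bigcup_open => a _; exact: ball_open.
have [V AV VU] := sA _ AU.
have [z xz] : neg_omega_limit f x !=set0.
  by apply: (neg_omega_limit_nonempty (@norm_le_compact R n M)).
have : region_of_attraction f A z by rewrite Aall.
move=> [[y zy] zA].
have /set_nbhsP[V' [oV' AV' V'V]] := AV.
have [t _ Vt] := (omega_limitP f z y).1 zy _
  (open_nbhs_nbhs (conj oV' (AV' _ (zA _ zy)))) 0.
have [s st Vs] := (neg_omega_limitP f x z).1 xz _
  (flow_continuousl f_flow (open_nbhs_nbhs (conj oV' Vt))) (- t).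
have : U x.
  rewrite -[x](flowK f_flow x (s + t)); apply: VU.
    by rewrite -(flowD f_flow); exact: V'V.
  by rewrite oppr_ge0 -lerBrDr sub0r.
by move=> [a Aa ax]; exists a; split => //; apply: eW; exact: ball_sym.
Qed.

(** Compactness of omega-limits replaces point attraction by attraction of whole
    compact sets: a sequence of orbit pieces staying outside [V] for longer and
    longer times accumulates, in the middle, on a bounded full orbit. *)
Lemma bounded_orbits_attract (Q V : set 'rV[R]_n) (M : R) :
  open V -> bounded_orbits f `<=` V ->
  (forall x t, Q x -> 0 <= t -> `|f x t| <= M) ->
  exists2 T, 0 < T & forall x t, Q x -> T <= t -> V (f x t).
Proof.
move=> oV GV QM; apply: contrapT => noT.
have bad (T : R) : exists p : 'rV[R]_n * R, [/\ Q p.1, T <= p.2 & ~ V (f p.1 p.2)].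
  apply: contrapT => noxt; apply: noT; exists (Num.max T 1).
    by rewrite lt_max ltr01 orbT.
  move=> x t Qx; rewrite ge_max => /andP[Tt _].
  by apply: contrapT => nV; apply: noxt; exists (x, t).
have [p pP] := choice bad.
pose u (T : R) := f (p T).1 (p T).2.
have uM : (u @ +oo) [set y | `|y| <= M].
  exists 0; split; first exact: num_real.
  by move=> T /ltW T0; have [? ? ?] := pP T; apply: QM => //; apply: le_trans T0 _.
have [y [_ cy]] := @norm_le_compact R n M _ _ uM.
have late (T : R) W : nbhs y W -> exists2 T', T <= T' & W (u T').
  move=> yW; have [|_ [[T' /= TT' <-] Wu]] := cy [set u T' | T' in [set T' | T <= T']] W _ yW.
    by exists T; split; [exact: num_real|move=> T' /ltW ?; exists T'].
  by exists T'.
have /GV Vy : bounded_orbits f y.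
  exists M => s; rewrite leNgt; apply/negP => Ms.
  have oW : open [set z | M < `|f z s|] by apply: open_norm_gt; exact: flow_continuousl.
  have [T sT] := late (- s) _ (open_nbhs_nbhs (conj oW Ms)).
  have [QT Tt _] := pP T.
  rewrite /u /= flowD// ltNge => /negP; apply; apply: QM => //.
  by rewrite -lerBlDr sub0r (le_trans sT).
have [T _] := late 0 _ (open_nbhs_nbhs (conj oV Vy)).
by have [] := pP T.
Qed.

Hypothesis f_diss : dissipative f.

Lemma dissipative_absorbing :
  exists2 r0 : R, 0 < r0 & forall x T, exists2 t, T <= t & `|f x t| < r0.
Proof.
have [ne cpt] := f_diss; have [M HM] := compact_norm_le cpt.
exists (Num.max M 0 + 1); first by rewrite ltr_wpDl// le_max lexx orbT.
move=> x T; have [y xy] := ne x.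
have yM : `|y| < Num.max M 0 + 1.
  rewrite ltr_pwDr// le_max; apply/orP; left; apply: HM.
  by apply: subset_closure; exists x.
have oW : open [set z : 'rV[R]_n | `|z| < Num.max M 0 + 1].
  by apply: (@open_norm_lt _ _ _ id) => ?; exact: cvg_id.
exact: (omega_limitP f x y).1 xy _ (open_nbhs_nbhs (conj oW yM)) T.
Qed.

(** The points of a large ball come back to it after a time between [1] and a
    uniform [T].  Until then the orbit stays in the image of the ball under the
    flow during [[0, T]]; since a return takes at least one unit of time, an
    induction on the integer part of [t] iterates this. *)
Lemma dissipative_forward_bounded (a : R) :
  exists M : R, forall x t, `|x| <= a -> 0 <= t -> `|f x t| <= M.
Proof.
have [r0 r0_gt0 absorb] := dissipative_absorbing.
pose b := Num.max a r0.
have back : \forall T \near +oo, [set x : 'rV[R]_n | `|x| <= b] `<=`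
    (fun x => exists2 t, 1 <= t <= T & `|f x t| <= b).
  apply: (compact_near_coveringP _).1 (@norm_le_compact R n b) _ _ _ _ _.
  move=> x _; have [t t1 xt] := absorb x 1.
  have oW : open [set z | `|f z t| < r0] by apply: open_norm_lt; exact: flow_continuousl.
  exists ([set z | `|f z t| < r0], [set T | t <= T]).
    split; first exact: (open_nbhs_nbhs (conj oW xt)).
    by exists t; split; [exact: num_real|move=> ? /ltW].
  move=> [z T] /= [zt tT]; exists t; first by rewrite t1.
  by rewrite le_max (ltW zt) orbT.
have [T T1 {}back] := pinfty_ex_gt (num_real 1) back.
have [M HM] : exists M : R, forall x t, `|x| <= b -> 0 <= t <= T -> `|f x t| <= M.
  have : compact [set f p.1 p.2 | p in [set x : 'rV[R]_n | `|x| <= b] `*` `[0, T]].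
    apply: continuous_compact; first exact: continuous_subspaceT (flow_continuous f_flow).
    by apply: compact_setX; [exact: norm_le_compact|exact: segment_compact].
  move=> /compact_norm_le[M HM]; exists M => x t xb tT; apply: HM.
  by exists (x, t) => //; split => //=; rewrite in_itv.
exists M => x t xa t0.
have xb : `|x| <= b by rewrite le_max xa.
have := ltW (truncnS_gt t); move: (Num.trunc t).+1 => k.
elim: k x t {xa} xb t0 => [|k IH] x t xb t0 tk.
  by apply: HM; rewrite // t0 (le_trans tk)// ltW// (lt_trans ltr01).
have [tT|Tt] := leP t T; first by apply: HM; rewrite // t0.
have [s /andP[s1 sT] sb] := back x xb.
rewrite (_ : t = s + (t - s)); last by rewrite addrC subrK.
rewrite -flowD//; apply: IH => //; first by rewrite subr_ge0 (le_trans sT)// ltW.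
by rewrite lerBlDr (le_trans tk)// -natr1 lerD2l.
Qed.

(** A bounded orbit visits the absorbing ball at some negative time, because its
    backward limit points visit it. *)
Lemma bounded_orbits_bounded : exists M : R, forall x, bounded_orbits f x -> `|x| <= M.
Proof.
have [r0 _ absorb] := dissipative_absorbing.
have [M HM] := dissipative_forward_bounded r0.
exists M => x [Mx xMx].
have [y xy] : neg_omega_limit f x !=set0.
  by apply: (neg_omega_limit_nonempty (@norm_le_compact R n Mx)).
have [s _ ys] := absorb y 0.
have oW : open [set z | `|f z s| < r0] by apply: open_norm_lt; exact: flow_continuousl.
have [t ts /= xt] := (neg_omega_limitP f x y).1 xy _ (open_nbhs_nbhs (conj oW ys)) (- s).
rewrite -[x](flowK f_flow x (t + s)); apply: HM.
  by rewrite -flowD// ltW.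
by rewrite oppr_ge0 -lerBrDr sub0r.
Qed.

Lemma bounded_orbits_compact : compact (bounded_orbits f).
Proof.
have [M HM] := bounded_orbits_bounded.
apply: bounded_closed_compact; first by apply/bounded_setP; exists M.
move=> x xG; exists M => t; rewrite leNgt; apply/negP => Mt.
have oW : open [set z | M < `|f z t|] by apply: open_norm_gt; exact: flow_continuousl.
have [y [Gy /=]] := xG _ (open_nbhs_nbhs (conj oW Mt)).
by rewrite ltNge HM//; exact: bounded_orbits_invariant.
Qed.

Lemma bounded_orbits_attract_ball (a : R) (V : set 'rV[R]_n) :
  open V -> bounded_orbits f `<=` V ->
  exists2 T, 0 < T & forall x t, `|x| <= a -> T <= t -> V (f x t).
Proof.
move=> oV GV; have [M HM] := dissipative_forward_bounded a.
exact: (@bounded_orbits_attract [set x | `|x| <= a] V M).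
Qed.

End bounded_orbits.

(** * Connectedness in euclidean space *)

Section connectedness.
Variables (R : realType) (n : nat).
Implicit Types (x y c : 'rV[R]_n).

Lemma rV_segment_connected x y : connected [set x + t *: (y - x) | t in `[0 : R, 1]].
Proof.
apply: connected_continuous_connected.
  by apply/connected_intervalP; exact: interval_is_interval.
apply: continuous_subspaceT => t.
by apply: cvgD; [exact: cvg_cst|apply: cvgZ; [exact: cvg_id|exact: cvg_cst]].
Qed.

Lemma star_connected (A : set 'rV[R]_n) c :
  (forall x t, A x -> 0 <= t <= 1 -> A (c + t *: (x - c))) -> connected A.
Proof.
move=> Astar.
rewrite (_ : A = \bigcup_(x in A) [set c + t *: (x - c) | t in `[0 : R, 1]]).
  apply: bigcup_connected => [|x _]; last exact: rV_segment_connected.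
  exists c => x _; exists 0; last by rewrite scale0r addr0.
  by rewrite /= in_itv /= lexx ler01.
apply/seteqP; split=> [x Ax|z [x Ax] [t t01 <-]].
  exists x => //; exists 1; last by rewrite scale1r addrC subrK.
  by rewrite /= in_itv /= lexx ler01.
by apply: Astar => //; move: t01; rewrite /= in_itv.
Qed.

Lemma connected_norm_lt (a : R) : connected [set x : 'rV[R]_n | `|x| < a].
Proof.
apply: (@star_connected _ 0) => x u /= xa /andP[t0 t1].
rewrite add0r subr0 normrZ ger0_norm//; apply: le_lt_trans xa.
by rewrite ler_piMl.
Qed.

Lemma rV_coord_le x i : `|x ord0 i| <= `|x|.
Proof.
rewrite [leRHS](mx_normrE x); apply/bigmax_geP; right => /=.
by exists (ord0, i).
Qed.

Lemma rV_norm_lt_coord x (a : R) : 0 <= a -> a < `|x| -> exists i, a < `|x ord0 i|.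
Proof.
move=> a0 ax; apply: contrapT => small; move: ax; apply/negP; rewrite -leNgt.
rewrite [leLHS](mx_normrE x); apply/bigmax_leP; split => // -[j i] _ /=.
by rewrite [j]ord1 leNgt; apply/negP => ?; apply: small; exists i.
Qed.

(** The complement of a sup-norm ball is a union of half-spaces; two of them
    that are not opposite meet, and opposite ones both meet a third one because
    there is another coordinate. *)
Lemma connected_norm_gt (a : R) : (1 < n)%N -> 0 <= a ->
  connected [set x : 'rV[R]_n | a < `|x|].
Proof.
move=> n1 a0.
pose H (s : bool) (i : 'I_n) := [set x : 'rV[R]_n | a < (-1) ^+ s * x ord0 i].
have HA s i : H s i `<=` [set x : 'rV[R]_n | a < `|x|].
  move=> x /= xi; apply: lt_le_trans (rV_coord_le x i).
  apply: (lt_le_trans xi); apply: le_trans (ler_norm _) _.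
  by rewrite normrMsign.
have cH s i : connected (H s i).
  pose c : 'rV[R]_n := \row_j ((-1) ^+ s * (a + 1)).
  apply: (@star_connected _ c) => x t; rewrite /H /= !mxE => xi /andP[t0 t1].
  have ss : (-1) ^+ s * (-1) ^+ s = 1 :> R by rewrite -expr2 sqrr_sign.
  have -> : (-1) ^+ s * ((-1) ^+ s * (a + 1) + t * (x ord0 i - (-1) ^+ s * (a + 1))) =
      (-1) ^+ s * (-1) ^+ s * (a + 1) +
      t * ((-1) ^+ s * x ord0 i - (-1) ^+ s * (-1) ^+ s * (a + 1)) by ring.
  rewrite ss mul1r; set y := _ * x ord0 i in xi *.
  have : 0 <= t * (y - a) by rewrite mulr_ge0// subr_ge0 ltW.
  have [->|] := eqVneq t 1; first by lra.
  by move=> t1' ?; have : t < 1 by [rewrite lt_neqAle t1' t1]; lra.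
have meet s i s' j : i != j -> (H s i `&` H s' j) !=set0.
  move=> ij; exists (\row_k if k == i then (-1) ^+ s * (a + 1) else (-1) ^+ s' * (a + 1)).
  split; rewrite /H /= mxE ?eqxx ?[j == i]eq_sym ?(negbTE ij);
  by rewrite mulrA -expr2 sqrr_sign mul1r ltrDl.
have hop s i x y : H s i x -> H s i y -> connected_component [set x : 'rV[R]_n | a < `|x|] x y.
  by move=> xi yi; apply: (@connected_component_max _ _ (H s i)).
have link s i s' j x y : i != j -> H s i x -> H s' j y ->
    connected_component [set x : 'rV[R]_n | a < `|x|] x y.
  move=> ij xi yj; have [z [zi zj]] := meet s i s' j ij.
  exact: connected_component_trans (hop _ _ _ _ xi zi) (hop _ _ _ _ zj yj).
have half x : a < `|x| -> exists s i, H s i x.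
  move=> /(rV_norm_lt_coord a0)[i xi]; exists (x ord0 i < 0), i.
  by rewrite /H /= -normrEsign.
have [[x0 ax0]|none] := pselect (exists x : 'rV[R]_n, a < `|x|); last first.
  rewrite (_ : mkset _ = set0); first exact: connected0.
  by apply/seteqP; split => x //= ax; apply: none; exists x.
rewrite (_ : mkset _ = connected_component [set x : 'rV[R]_n | a < `|x|] x0).
  exact: component_connected.
apply/seteqP; split; last exact: connected_component_sub.
move=> x /half[s [i xi]]; have [s0 [i0 x0i]] := half _ ax0.
have [E|ne] := eqVneq i0 i; last exact: link ne x0i xi.
have [j ji] : exists j : 'I_n, i != j.
  have [E'|] := eqVneq i (Ordinal n1); last by exists (Ordinal n1).
  by exists (Ordinal (ltnW n1)); rewrite E'.
have [z [_ zj]] := meet s i true j ji.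
rewrite -E in xi ji *.
exact: connected_component_trans (link _ _ _ _ _ _ ji x0i zj)
  (connected_component_sym (link _ _ _ _ _ _ ji xi zj)).
Qed.

Lemma open_separated (T : topologicalType) (A B : set T) :
  open A -> open B -> A `&` B = set0 -> separated A B.
Proof.
move=> oA oB AB; split; apply/seteqP; split=> // z [].
  by move=> clA Bz; have [w] := clA _ (open_nbhs_nbhs (conj oB Bz)); rewrite AB.
move=> Az clB; have [w] := clB _ (open_nbhs_nbhs (conj oA Az)).
by rewrite setIC AB.
Qed.

Lemma connected_component_separated (T : topologicalType) (A B : set T) (x : T) :
  separated A B -> connected A -> A x -> connected_component (A `|` B) x = A.
Proof.
move=> sAB cA Ax.
apply/seteqP; split; last first.
  by apply: connected_component_max => //; exact: subsetUl.
have [//|] := connected_subset sAB (@connected_component_sub _ _ x)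
  (@component_connected _ _ x).
move=> /(_ x (connected_component_refl (or_introl Ax))) Bx.
by exfalso; suff : set0 x by []; rewrite -(separated_disjoint sAB).
Qed.

End connectedness.

(** * The dual repeller of an attractor with bounded basin *)

Definition traps_ball (R : realType) (n : nat) (f : 'rV[R]_n -> R -> 'rV[R]_n)
    (r T : R) : Prop :=
  forall x t, `|x| <= r -> T <= t -> `|f x t| < r.

(** The repeller dual to the attractor [K] inside the global attractor, in the
    sense of Conley. *)
Definition dual_repeller (R : realType) (n : nat)
    (f : 'rV[R]_n -> R -> 'rV[R]_n) (K : set 'rV[R]_n) : set 'rV[R]_n :=
  bounded_orbits f `\` region_of_attraction f K.

Section dual_repeller.
Variables (R : realType) (n : nat) (f : 'rV[R]_n -> R -> 'rV[R]_n).
Hypotheses (f_flow : is_flow f) (f_diss : dissipative f).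
Variables (K : set 'rV[R]_n) (r T : R).
Hypotheses (r_gt0 : 0 < r) (f_traps : traps_ball f r T).
Hypothesis isoK : isolating_nbhd f K [set x : 'rV[R]_n | `|x| <= r].
Implicit Types (x y : 'rV[R]_n) (s t : R).

Local Notation A := (region_of_attraction f K).
Local Notation G := (bounded_orbits f).
Local Notation C := (dual_repeller f K).

Lemma isolated_norm_lt y : K y -> `|y| < r.
Proof.
have [_ KN iK _] := isoK => Ky.
rewrite -[y](flowNK f_flow y T); apply: f_traps => //.
exact: (nbhs_singleton (KN _ (iK _ _ Ky))).
Qed.

Lemma ball_sub_basin x : `|x| <= r -> A x.
Proof.
have [_ _ _ maxK] := isoK => xr; split.
  apply: (@omega_limit_nonempty _ _ _ _ _ T (@norm_le_compact R n r)).
  by move=> t /(f_traps xr)/ltW.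
apply: maxK; first exact: omega_limit_invariant.
apply: (@omega_limit_closed _ _ _ _ _ T); first exact: closed_norm_le.
by move=> t /(f_traps xr)/ltW.
Qed.

Lemma basinP x : A x <-> exists t, `|f x t| < r.
Proof.
split=> [[[y xy] xK]|[t /ltW/ball_sub_basin]].
  have oW : open [set z : 'rV[R]_n | `|z| < r].
    by apply: (@open_norm_lt _ _ _ id) => ?; exact: cvg_id.
  have [t _ xt] := (omega_limitP f x y).1 xy _
    (open_nbhs_nbhs (conj oW (isolated_norm_lt (xK _ xy)))) 0.
  by exists t.
rewrite -{2}[x](flowK f_flow x t).
exact: (region_of_attraction_invariant f_flow).
Qed.

Lemma basin_trapped x : A x -> exists s, forall t, s <= t -> `|f x t| < r.
Proof.
move=> /basinP[s xs]; exists (s + T) => t st.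
rewrite (_ : t = s + (t - s)); last by rewrite addrC subrK.
by rewrite -(flowD f_flow); apply: f_traps; [exact: ltW|rewrite lerBrDl].
Qed.

Lemma basin_open : open A.
Proof.
rewrite (_ : A = \bigcup_t [set x | `|f x t| < r]).
  by apply: bigcup_open => t _; apply: open_norm_lt; exact: flow_continuousl.
by apply/seteqP; split=> x => [/basinP[t]|[t _]]; [exists t|move=> ?; apply/basinP; exists t].
Qed.

(** The basin is the union of the backward images of the trapped ball at times
    later than [T], all of which contain the origin. *)
Lemma basin_connected : connected A.
Proof.
pose D t := [set f x (- t) | x in [set x : 'rV[R]_n | `|x| < r]].
rewrite (_ : A = \bigcup_(t in [set t | T <= t]) D t).
  apply: bigcup_connected.
    exists 0 => t /= Tt; exists (f 0 t); last exact: flowK.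
    by rewrite /= f_traps// normr0 ltW.
  move=> t _; apply: connected_continuous_connected; first exact: connected_norm_lt.
  exact: continuous_subspaceT (flow_continuousl f_flow (t := _)).
apply/seteqP; split=> [x /basin_trapped[s xs]|_ [t _ [x xr <-]]].
  exists (Num.max s T); first by rewrite /= le_max lexx orbT.
  exists (f x (Num.max s T)); last exact: flowK.
  by rewrite /= xs// le_max lexx.
by apply/basinP; exists t; rewrite flowNK.
Qed.

Lemma isolated_sub_basin : K `<=` A.
Proof. by move=> x /isolated_norm_lt/ltW/ball_sub_basin. Qed.

Hypothesis A_bounded : bounded_set A.

Lemma basin_sub_bounded_orbits : A `<=` G.
Proof.
by apply: bounded_invariant_sub => //; exact: region_of_attraction_invariant.
Qed.

Lemma dual_repeller_compact : compact C.
Proof.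
rewrite /dual_repeller setDE; apply: compact_closedI; first exact: bounded_orbits_compact.
by apply: open_closedC; exact: basin_open.
Qed.

Lemma dual_repeller_invariant : Defs.invariant f C.
Proof.
move=> x t [Gx nAx]; split; first exact: bounded_orbits_invariant.
move=> At; apply: nAx; rewrite -[x](flowK f_flow x t).
exact: region_of_attraction_invariant.
Qed.

Lemma out_of_basin_norm_gt x : ~ A x -> r < `|x|.
Proof. by move=> nAx; rewrite ltNge; apply/negP => /ball_sub_basin. Qed.

(** An invariant set in the shell between the trapped ball and a ball around the
    global attractor has bounded orbits, and avoids the basin because basin
    orbits enter the trapped ball. *)
Lemma dual_repeller_isolated : isolated_invariant f C.
Proof.
split; [exact: dual_repeller_compact|exact: dual_repeller_invariant|].
have [M HM] := bounded_orbits_bounded f_flow f_diss.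
exists ([set x : 'rV[R]_n | `|x| <= M + 1] `&` [set x : 'rV[R]_n | r <= `|x|]); split.
- by apply: compact_closedI; [exact: norm_le_compact|exact: closed_norm_ge].
- apply/set_nbhsP.
  exists ([set x : 'rV[R]_n | `|x| < M + 1] `&` [set x : 'rV[R]_n | r < `|x|]); split.
  + apply: openI; [apply: (@open_norm_lt _ _ _ id)|apply: (@open_norm_gt _ _ _ id)];
    by move=> ?; exact: cvg_id.
  + move=> x [Gx nAx]; split => /=; last exact: out_of_basin_norm_gt.
    by rewrite (le_lt_trans (HM _ Gx))// ltrDl.
  + by move=> x [/= ? ?]; split; exact: ltW.
- exact: dual_repeller_invariant.
- move=> L iL LN x Lx; split.
    apply: (bounded_invariant_sub iL) Lx.
    by apply/bounded_setP; exists (M + 1) => y /LN[].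
  by move=> /basinP[t]; rewrite ltNge => /negP; apply; have [] := LN _ (iL _ t Lx).
Qed.

(** A neighbourhood of the dual repeller together with the basin is a
    neighbourhood of the global attractor, and the basin is not entered from
    outside. *)
Lemma dual_repeller_attract (Q V : set 'rV[R]_n) :
  bounded_set Q -> (forall x, Q x -> ~ A x) -> set_nbhs C V ->
  exists2 s, 0 < s & forall x t, Q x -> s <= t -> V (f x t).
Proof.
move=> /bounded_setP[M QM] QA /set_nbhsP[V' [oV' CV' V'V]].
have oVA : open (V' `|` A) by apply: openU => //; exact: basin_open.
have GVA : G `<=` V' `|` A.
  by move=> x Gx; have [|nAx] := pselect (A x); [right|left; apply: CV'].
have [s s0 Hs] := bounded_orbits_attract_ball f_flow f_diss M oVA GVA.
exists s => // x t Qx st.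
have [/V'V //|At] := Hs x t (QM _ Qx) st.
exfalso; apply: (QA x Qx); rewrite -[x](flowK f_flow x t).
exact: region_of_attraction_invariant.
Qed.

Lemma dual_repeller_attracts_uniformly x : ~ G x -> attracts_uniformly f C x.
Proof.
move=> nGx V CV; pose Q := ~` G `&` [set y : 'rV[R]_n | `|y| < `|x| + 1].
have oQ : open Q.
  apply: openI; last by apply: (@open_norm_lt _ _ _ id) => ?; exact: cvg_id.
  by apply: closed_openC; apply: rV_compact_closed; exact: bounded_orbits_compact.
have [|y [nGy _] /basin_sub_bounded_orbits//|s s0 Hs] := @dual_repeller_attract Q V _ _ CV.
  by apply/bounded_setP; exists (`|x| + 1) => y [_ /ltW].
exists Q, s; split => //.
by apply: open_nbhs_nbhs; split => //; split => //=; rewrite ltrDl.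
Qed.

(** A backward limit point inside the basin would return to the trapped ball at
    arbitrarily negative times, confining the whole orbit to that ball. *)
Lemma dual_repeller_repels x : A x -> ~ K x -> repels f C x.
Proof.
move=> Ax nKx; have /bounded_setP[M AM] := A_bounded.
have iA : Defs.invariant f A by exact: region_of_attraction_invariant.
split.
  by apply: (neg_omega_limit_nonempty (@norm_le_compact R n M)) => t; exact/AM/iA.
move=> y /neg_omega_limitP xy; split.
  apply: (rV_compact_closed (bounded_orbits_compact f_flow f_diss)) => V yV.
  have [t _ Vt] := xy V yV 0; exists (f x t); split => //.
  exact/basin_sub_bounded_orbits/iA.
move=> /basinP[s ys]; apply: nKx.
have [_ _ _ maxK] := isoK; apply: (maxK [set f x t | t in setT]).
- by move=> _ t [u _ <-]; exists (u + t); rewrite ?flowD.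
- move=> _ [t _ <-] /=.
  have oW : open [set z | `|f z s| < r] by apply: open_norm_lt; exact: flow_continuousl.
  have [u ut xu] := xy _ (open_nbhs_nbhs (conj oW ys)) (t - s - T).
  rewrite (_ : t = u + s + (t - (u + s))); last by rewrite addrC subrK.
  rewrite -(flowD f_flow) -(flowD f_flow x u); apply/ltW/f_traps; first exact: ltW.
  by move: ut; lra.
- by exists 0; rewrite ?flow0.
Qed.

(** Every orbit outside the global attractor leaves each ball, so it joins the
    complement of a large ball, which is connected. *)
Lemma compl_bounded_orbits_connected : (1 < n)%N -> connected (~` G).
Proof.
move=> n1; have [M HM] := bounded_orbits_bounded f_flow f_diss.
pose a := Num.max M 0.
have far_sub : [set x : 'rV[R]_n | a < `|x|] `<=` ~` G.
  by move=> x /= ax /HM; apply/negP; rewrite -ltNge (le_lt_trans _ ax)// le_max lexx.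
have far_connected : connected [set x : 'rV[R]_n | a < `|x|].
  by apply: connected_norm_gt => //; rewrite le_max lexx orbT.
have to_far x : ~ G x -> exists2 z, a < `|z| & connected_component (~` G) x z.
  move=> nGx; have [t axt] : exists t, a < `|f x t|.
    apply: contrapT => no; apply: nGx; exists a => t.
    by rewrite leNgt; apply/negP => axt; apply: no; exists t.
  exists (f x t) => //.
  apply: (@connected_component_max _ _ [set f x s | s in setT]).
  - by exists 0; rewrite ?flow0.
  - move=> _ [s _ <-] Gxs; apply: nGx; rewrite -[x](flowK f_flow x s).
    exact: bounded_orbits_invariant.
  - apply: connected_continuous_connected; first exact/connected_intervalP.
    by apply: continuous_subspaceT => s; exact: flow_continuousr.
  - by exists t.
have [[x0 nGx0]|none] := pselect (exists x, ~ G x); last first.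
  rewrite (_ : ~` G = set0); first exact: connected0.
  by apply/seteqP; split => // x nGx; apply: none; exists x.
rewrite (_ : ~` G = connected_component (~` G) x0); first exact: component_connected.
apply/seteqP; split; last exact: connected_component_sub.
move=> x /to_far[z az xz]; have [z0 az0 x0z0] := to_far _ nGx0.
apply: connected_component_trans x0z0 _.
apply: connected_component_trans (connected_component_sym xz).
by apply: (@connected_component_max _ _ [set x : 'rV[R]_n | a < `|x|]).
Qed.

Lemma dual_repeller_compl : ~` C = A `|` ~` G.
Proof.
rewrite /dual_repeller setDE setCI setCK setUC.
by [].
Qed.

Lemma dual_repeller_separates : (1 < n)%N -> separates_into C A (~` G).
Proof.
move=> n1; have [M HM] := bounded_orbits_bounded f_flow f_diss.
have oG : open (~` G).
  by apply: closed_openC; apply: rV_compact_closed; exact: bounded_orbits_compact.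
have AG : A `&` ~` G = set0.
  by apply/seteqP; split => // x [/basin_sub_bounded_orbits].
pose far (a : R) : 'rV[R]_n := \row_i (Num.max a M + 1).
have farP a : a < `|far a| /\ M < `|far a|.
  have i : 'I_n by exact: Ordinal (ltnW n1).
  have : Num.max a M < `|far a|.
    apply: (lt_le_trans _ (rV_coord_le _ i)); rewrite mxE.
    by apply: lt_le_trans (ler_norm _); rewrite ltrDl.
  by rewrite gt_max => /andP[].
have farG a : ~ G (far a).
  by move=> /HM; apply/negP; rewrite -ltNge; have [] := farP a.
split=> //; last first.
  move=> /bounded_setP[M' /(_ (far M') (farG M'))]; apply/negP; rewrite -ltNge.
  by have [] := farP M'.
rewrite dual_repeller_compl.
have compA x : A x -> connected_component (A `|` ~` G) x = A.
  apply: connected_component_separated; last exact: basin_connected.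
  exact: open_separated basin_open oG AG.
have compG x : ~ G x -> connected_component (A `|` ~` G) x = ~` G.
  rewrite setUC; apply: connected_component_separated; last first.
    exact: compl_bounded_orbits_connected.
  by apply: open_separated => //; [exact: basin_open|rewrite setIC].
apply/seteqP; split=> [_ [x [Ax|nGx] <-]|_ [->|->]].
- by left; exact: compA.
- by right; exact: compG.
- exists 0; last by apply: compA; apply: ball_sub_basin; rewrite normr0 ltW.
  by left; apply: ball_sub_basin; rewrite normr0 ltW.
- by exists (far 0); [right; exact: farG|apply: compG; exact: farG].
Qed.

(** Two opposite half-lines from the origin start in the basin, which contains
    the ball of radius [r] and is bounded, so both meet its boundary, hence the
    dual repeller, at distance more than [r] from the origin. *)
Lemma dual_repeller_diam : (0 < n)%N -> (r%:E <= diam C)%E.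
Proof.
move=> n0; pose i : 'I_n := Ordinal n0.
have /bounded_setP[M AM] := A_bounded.
have ray (v : 'rV[R]_n) : `|v| = 1 -> exists2 u : R, r < u & C (u *: v).
  move=> v1.
  pose e := (Num.max M 0 + 1) *: v.
  apply: contrapT => noC.
  have oG : open (~` G).
    by apply: closed_openC; apply: rV_compact_closed; exact: bounded_orbits_compact.
  have AG : A `&` ~` G = set0.
    by apply/seteqP; split => // x [/basin_sub_bounded_orbits].
  have M0 : 0 < Num.max M 0 + 1 by rewrite ltr_wpDl// le_max lexx orbT.
  have [|LA|LG] := connected_subset (open_separated basin_open oG AG) _
    (@rV_segment_connected R n 0 e).
  - rewrite -dual_repeller_compl => z [t] /[swap] <-.
    rewrite /= in_itv /= => /andP[t0 t1].
    rewrite subr0 add0r scalerA => Ct; apply: noC; exists (t * (Num.max M 0 + 1)) => //.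
    have [_ /out_of_basin_norm_gt] := Ct.
    by rewrite normrZ v1 mulr1 ger0_norm// mulr_ge0// ltW.
  - have /LA/AM : [set 0 + t *: (e - 0) | t in `[0 : R, 1]] e.
      by exists 1; [rewrite /= in_itv /= lexx ler01|rewrite scale1r subr0 add0r].
    rewrite normrZ v1 mulr1 gtr0_norm//; apply/negP; rewrite -ltNge.
    by rewrite ltr_pwDr// le_max lexx.
  - have /LG : [set 0 + t *: (e - 0) | t in `[0 : R, 1]] 0.
      by exists 0; [rewrite /= in_itv /= lexx ler01|rewrite scale0r addr0].
    by apply; apply/basin_sub_bounded_orbits/ball_sub_basin; rewrite normr0 ltW.
pose v : 'rV[R]_n := const_mx 1.
have v1 : `|v| = 1.
  apply/eqP; rewrite eq_le; apply/andP; split.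
    rewrite leNgt; apply/negP => /(rV_norm_lt_coord ler01)[j].
    by rewrite mxE normr1 ltxx.
  by have := rV_coord_le v i; rewrite mxE normr1.
have [u ru Cu] := ray v v1.
have [w rw Cw] : exists2 w : R, r < w & C (w *: - v) by apply: ray; rewrite normrN.
apply: le_trans (ereal_sup_ubound _); last first.
  by exists (u *: v, w *: - v); [split|reflexivity].
rewrite lee_fin /= /euclid_dist.
have uw : r <= u + w by have := r_gt0; lra.
apply: (le_trans uw); rewrite -[leLHS]ger0_norm; last by have := r_gt0; lra.
rewrite -sqrtr_sqr ler_wsqrtr// (bigD1 i)//= !mxE mulrN opprK !mulr1 lerDl.
by apply: sumr_ge0 => j _; exact: sqr_ge0.
Qed.

End dual_repeller.

(** * Homotopies and radial maps *)

Section cvg_lemmas.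
Variables (R : realType) (I : Type) (F : set_system I).
Context {FF : Filter F}.

Lemma cvg_minr (u v : I -> R) (a b : R) : u z @[z --> F] --> a ->
  v z @[z --> F] --> b -> Num.min (u z) (v z) @[z --> F] --> Num.min a b.
Proof.
move=> ua vb; apply: (@continuous2_cvg _ _ _ _ F FF u v Num.min) => //.
exact: (@min_continuous _ R (a, b)).
Qed.

Lemma cvg_maxr (u v : I -> R) (a b : R) : u z @[z --> F] --> a ->
  v z @[z --> F] --> b -> Num.max (u z) (v z) @[z --> F] --> Num.max a b.
Proof.
move=> ua vb; apply: (@continuous2_cvg _ _ _ _ F FF u v Num.max) => //.
exact: (@max_continuous _ R (a, b)).
Qed.

Lemma cvg_pairr (U V : topologicalType) (u : I -> U) (v : I -> V) (a : U) (b : V) :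
  u z @[z --> F] --> a -> v z @[z --> F] --> b ->
  (u z, v z) @[z --> F] --> (a, b).
Proof. exact: cvg_pair. Qed.

End cvg_lemmas.

Section homotopies.
Variables (R : realType) (n : nat).
Implicit Types (U V : set 'rV[R]_n) (f g h : 'rV[R]_n -> 'rV[R]_n).

Lemma within_continuous_cvg (X Y Z : topologicalType) (D : set X) (E : set Y)
    (a : X -> Y) (h : Y -> Z) (p : X) :
  {within E, continuous h} -> {for p, continuous a} ->
  (forall q, D q -> E (a q)) -> D p ->
  h (a q) @[q --> within D (nbhs p)] --> h (a p).
Proof.
move=> /subspace_continuousP ch ca DE Dp.
apply: (@cvg_comp _ _ _ a h _ (within E (nbhs (a p)))); last exact/ch/DE.
move=> W /ca /= pW.
rewrite /nbhs/= /within /= in pW *.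
by apply: filterS pW => q /= qW /DE.
Qed.

Lemma homotopic_in_intro U V (H : 'rV[R]_n * R -> 'rV[R]_n) f g :
  (forall p, U p.1 -> 0 <= p.2 <= 1 -> {for p, continuous H}) ->
  (forall x t, U x -> 0 <= t <= 1 -> V (H (x, t))) ->
  (forall x, U x -> H (x, 0) = f x) -> (forall x, U x -> H (x, 1) = g x) ->
  homotopic_in U V f g.
Proof.
move=> cH HV H0 H1; exists H; split => //.
by apply: continuous_in_subspaceT => p /[!inE] -[Up p01]; exact: cH.
Qed.

(** In a vector space homotopies are concatenated without any gluing: run the
    first one, then the second one, add them up and subtract the common map. *)
Lemma homotopic_in_trans U V f g h :
  homotopic_in U V f g -> homotopic_in U V g h -> homotopic_in U V f h.
Proof.
move=> [H [cH H0 H1 HV]] [H' [cH' H'0 H'1 H'V]].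
pose a (p : 'rV[R]_n * R) := (p.1, Num.min 1 (2 * p.2)).
pose b (p : 'rV[R]_n * R) := (p.1, Num.max 0 (2 * p.2 - 1)).
pose c (p : 'rV[R]_n * R) := (p.1, 1 : R).
exists (fun p => H (a p) + H' (b p) - H (c p)).
have lower x t : U x -> t <= 1 / 2 ->
    H (a (x, t)) + H' (b (x, t)) - H (c (x, t)) = H (x, 2 * t).
  move=> Ux t2; rewrite /a /b /c /= min_r ?max_l; [|lra..].
  by rewrite H1// H'0// addrK.
have upper x t : U x -> 1 / 2 <= t ->
    H (a (x, t)) + H' (b (x, t)) - H (c (x, t)) = H' (x, 2 * t - 1).
  by move=> Ux t2; rewrite /a /b /c /= min_l ?max_r; [rewrite addrC addKr|lra..].
split=> /= [|x Ux|x Ux|x t Ux t01].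
- apply/subspace_continuousP => p [Up p01].
  have c2 (q : 'rV[R]_n * R) : 2 * z.2 @[z --> q] --> 2 * q.2.
    by apply: cvgM; [exact: cvg_cst|exact: cvg_snd].
  apply: cvgB; [apply: cvgD|].
  + apply: (@within_continuous_cvg _ _ _ _ _ a H p cH) => //.
      apply: cvg_pairr; first exact: cvg_fst.
      by apply: cvg_minr; [exact: cvg_cst|exact: c2].
    move=> q /= [Uq /andP[q0 q1]]; split=> //; rewrite le_min ler01 ge_min lexx /= andbT.
    by rewrite mulr_ge0.
  + apply: (@within_continuous_cvg _ _ _ _ _ b H' p cH') => //.
      apply: cvg_pairr; first exact: cvg_fst.
      apply: cvg_maxr; first exact: cvg_cst.
      by apply: cvgB; [exact: c2|exact: cvg_cst].
    move=> q /= [Uq /andP[q0 q1]]; split=> //; rewrite le_max lexx ge_max ler01 /=.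
    by rewrite lerBlDr; lra.
  + apply: (@within_continuous_cvg _ _ _ _ _ c H p cH) => //.
      by apply: cvg_pairr; [exact: cvg_fst|exact: cvg_cst].
    by move=> q /= [Uq _]; split => //; rewrite ler01 lexx.
- by rewrite lower// ?mulr0 ?H0// divr_ge0.
- have E : 2 * 1 - 1 = 1 :> R by ring.
  by rewrite upper ?E ?H'1//; lra.
- have [t2|/ltW t2] := leP t (1 / 2).
    by rewrite lower//; apply: HV => //; lra.
  by rewrite upper//; apply: H'V => //; lra.
Qed.

End homotopies.

Section radial.
Variables (R : realType) (n : nat).
Implicit Types (x y : 'rV[R]_n).

Local Notation enorm x := (euclid_dist x 0).

Lemma enormE x : enorm x = Num.sqrt (\sum_(i < n) x ord0 i ^+ 2).
Proof.
by rewrite /euclid_dist; congr Num.sqrt; apply: eq_bigr => i _; rewrite mxE subr0.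
Qed.

Lemma enorm_continuous : continuous (fun x : 'rV[R]_n => enorm x).
Proof.
rewrite (_ : (fun x => _) =
  fun x : 'rV[R]_n => Num.sqrt (\sum_(i < n) x ord0 i ^+ 2)); last first.
  by apply/funext => x; exact: enormE.
have sum_continuous := @continuous_big R 'I_n +%R 0 xpredT (@add_continuous R)
  'rV[R]_n (index_enum _) (fun i x => x ord0 i ^+ 2).
move=> x; apply: (@continuous_comp _ _ _ _ Num.sqrt x); last exact: sqrt_continuous.
apply: sum_continuous => i _ {}x.
by have xi := @coord_continuous R 1 n ord0 i x; exact: (cvgM xi xi).
Qed.

Lemma enormZ (a : R) x : enorm (a *: x) = `|a| * enorm x.
Proof.
rewrite !enormE (eq_bigr (fun i => a ^+ 2 * x ord0 i ^+ 2)); last first.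
  by move=> i _; rewrite mxE exprMn.
by rewrite -mulr_sumr sqrtrM ?sqr_ge0// sqrtr_sqr.
Qed.

Lemma norm_le_enorm x : `|x| <= enorm x.
Proof.
have e0 : 0 <= enorm x by exact: sqrtr_ge0.
rewrite leNgt; apply/negP => /(rV_norm_lt_coord e0)[i].
apply/negP; rewrite -leNgt enormE -sqrtr_sqr ler_wsqrtr// (bigD1 i)//= lerDl.
by apply: sumr_ge0 => j _; exact: sqr_ge0.
Qed.

Lemma enorm_le_norm x : enorm x <= n%:R * `|x|.
Proof.
rewrite enormE -[leRHS]ger0_norm ?mulr_ge0// -sqrtr_sqr ler_wsqrtr//.
apply: (@le_trans _ _ (n%:R * `|x| ^+ 2)).
  rewrite mulr_natl -[X in _ <= _ *+ X]card_ord -sumr_const; apply: ler_sum => i _.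
  rewrite -[leLHS]real_normK ?num_real//.
  by rewrite lerXn2r ?nnegrE//; exact: rV_coord_le.
rewrite exprMn ler_wpM2r ?sqr_ge0// -natrX ler_nat.
by case: n => // m; rewrite expnS expn1 leq_pmulr.
Qed.

Lemma unit_sphere_norm x : unit_sphere x -> 1 / n%:R <= `|x|.
Proof.
move=> x1; have := enorm_le_norm x; rewrite x1 => le1.
have n_gt0 : 0 < n%:R :> R.
  rewrite lt_neqAle ler0n andbT eq_sym; apply: contraTneq le1 => ->.
  by rewrite mul0r -ltNge.
by rewrite ler_pdivrMr// mulrC.
Qed.

Lemma norm_gt0_neq0 x (a : R) : 0 <= a -> a < `|x| -> x != 0.
Proof. by move=> a0 ax; rewrite -normr_gt0 (le_lt_trans a0). Qed.

(** Radial retraction onto the complement of the open ball of radius [a],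
    singular at the origin. *)
Definition push_out (a : R) x := (Num.max `|x| a / `|x|) *: x.

(** Radial retraction onto the closed ball of radius [a]. *)
Definition pull_in (a : R) x := (a / Num.max `|x| a) *: x.

Lemma push_out_cvg (I : Type) (F : set_system I) {FF : Filter F}
    (u : I -> 'rV[R]_n) (a : R) x :
  x != 0 -> u z @[z --> F] --> x -> push_out a (u z) @[z --> F] --> push_out a x.
Proof.
move=> x0 ux; apply: cvgZ => //; apply: cvgM.
  by apply: cvg_maxr; [exact: cvg_norm|exact: cvg_cst].
by apply: cvgV; [rewrite normr_eq0|exact: cvg_norm].
Qed.

Lemma pull_in_cvg (I : Type) (F : set_system I) {FF : Filter F}
    (u : I -> 'rV[R]_n) (a : R) x :
  0 < a -> u z @[z --> F] --> x -> pull_in a (u z) @[z --> F] --> pull_in a x.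
Proof.
move=> a0 ux; apply: cvgZ => //; apply: cvgM; first exact: cvg_cst.
apply: cvgV; first by rewrite gt_eqF// lt_max a0 orbT.
by apply: cvg_maxr; [exact: cvg_norm|exact: cvg_cst].
Qed.

Lemma push_out_norm (a : R) x : x != 0 -> `|push_out a x| = Num.max `|x| a.
Proof.
move=> x0; have x_gt0 : 0 < `|x| by rewrite normr_gt0.
rewrite normrZ ger0_norm; last by rewrite divr_ge0// le_max normr_ge0.
by rewrite divfK// gt_eqF.
Qed.

Lemma push_out_id (a : R) x : a <= `|x| -> push_out a x = x.
Proof.
move=> ax; rewrite /push_out max_l//; have [->|x0] := eqVneq x 0; first by rewrite scaler0.
by rewrite divff ?normr_eq0// scale1r.
Qed.

Lemma pull_in_id (a : R) x : 0 < a -> `|x| <= a -> pull_in a x = x.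
Proof. by move=> a0 xa; rewrite /pull_in max_r// divff ?gt_eqF// scale1r. Qed.

Lemma pull_in_norm (a : R) x : 0 < a -> `|pull_in a x| = Num.min `|x| a.
Proof.
move=> a0; rewrite normrZ ger0_norm; last by rewrite divr_ge0 ?(ltW a0)// le_max (ltW a0) orbT.
have [xa|ax] := leP `|x| a; first by rewrite divff ?gt_eqF// mul1r.
by rewrite divfK// gt_eqF// (lt_trans a0).
Qed.

Definition to_sphere (a : R) x := (a / `|x|) *: x.

Lemma to_sphere_cvg (I : Type) (F : set_system I) {FF : Filter F}
    (u : I -> 'rV[R]_n) (a : R) x :
  x != 0 -> u z @[z --> F] --> x -> to_sphere a (u z) @[z --> F] --> to_sphere a x.
Proof.
move=> x0 ux; apply: cvgZ => //; apply: cvgM; first exact: cvg_cst.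
by apply: cvgV; [rewrite normr_eq0|exact: cvg_norm].
Qed.

Lemma to_sphere_norm (a : R) x : 0 <= a -> x != 0 -> `|to_sphere a x| = a.
Proof.
move=> a0 x0; rewrite normrZ ger0_norm ?divr_ge0//.
by rewrite divfK// normr_eq0.
Qed.

Lemma to_sphereZ (a b : R) x : 0 < b -> to_sphere a (b *: x) = to_sphere a x.
Proof.
move=> b0; rewrite /to_sphere normrZ gtr0_norm// scalerA; congr (_ *: _).
by rewrite invfM mulrA mulrAC divfK// gt_eqF.
Qed.

End radial.

(** * The shape of the dual repeller *)

Section shape.
Variables (R : realType) (n : nat) (f : 'rV[R]_n -> R -> 'rV[R]_n).
Hypotheses (n_gt0 : (0 < n)%N) (f_flow : is_flow f) (f_diss : dissipative f).
Variables (K : set 'rV[R]_n) (r T : R).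
Hypotheses (r_gt0 : 0 < r) (f_traps : traps_ball f r T).
Hypothesis isoK : isolating_nbhd f K [set x : 'rV[R]_n | `|x| <= r].
Hypothesis A_bounded : bounded_set (region_of_attraction f K).
Implicit Types (x y : 'rV[R]_n) (s t : R).

Local Notation A := (region_of_attraction f K).
Local Notation G := (bounded_orbits f).
Local Notation C := (dual_repeller f K).
Local Notation enorm x := (euclid_dist x 0).

Let iA : Defs.invariant f A := region_of_attraction_invariant f_flow (K := K).

Lemma flow_basinE x t : A (f x t) <-> A x.
Proof.
by split=> [|/iA//]; move=> /(iA (- t)); rewrite flowK.
Qed.

Lemma norm_flow_gt x t : ~ A x -> r < `|f x t|.
Proof.
move=> nAx; apply: (out_of_basin_norm_gt f_flow f_traps isoK).
by rewrite flow_basinE.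
Qed.

Lemma basin_compact_trapped (Z : set 'rV[R]_n) :
  compact Z -> Z `<=` A -> exists s, 0 <= s /\ forall z, Z z -> `|f z s| < r.
Proof.
move=> cZ ZA.
have : \forall s \near +oo, Z `<=` (fun z => `|f z s| < r).
  apply: (compact_near_coveringP _).1 cZ _ _ _ _ _ => z /ZA.
  move=> /(basinP f_flow f_traps isoK)[s zs].
  have oW : open [set z | `|f z s| < r] by apply: open_norm_lt; exact: flow_continuousl.
  exists ([set z | `|f z s| < r], [set t | s + T <= t]).
    split; first exact: (open_nbhs_nbhs (conj oW zs)).
    by exists (s + T); split; [exact: num_real|move=> ? /ltW].
  move=> [y t] /= [ys st]; rewrite (_ : t = s + (t - s)); last by rewrite addrC subrK.
  by rewrite -(flowD f_flow); apply: f_traps; [exact: ltW|rewrite lerBrDl].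
by move=> /(pinfty_ex_gt (num_real 0))[s /ltW s0 Zs]; exists s.
Qed.

Definition normalize x := (enorm x)^-1 *: x.
Definition to_unit_sphere x := (Num.max (enorm x) r)^-1 *: x.

Lemma enorm_gt0 x : x != 0 -> 0 < enorm x.
Proof. by move=> x0; apply: lt_le_trans (norm_le_enorm x); rewrite normr_gt0. Qed.

Lemma normalize_sphere x : x != 0 -> unit_sphere (normalize x).
Proof.
move=> /enorm_gt0 x0; rewrite /unit_sphere /= enormZ gtr0_norm ?invr_gt0//.
by rewrite mulVf// gt_eqF.
Qed.

Lemma normalizeZ (a : R) x : 0 < a -> normalize (a *: x) = normalize x.
Proof.
move=> a0; rewrite /normalize enormZ gtr0_norm// scalerA invfM mulrAC mulVf ?mul1r//.
by rewrite gt_eqF.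
Qed.

Lemma to_unit_sphereE x : r < `|x| -> to_unit_sphere x = normalize x.
Proof.
move=> rx; rewrite /to_unit_sphere max_l//.
by apply: le_trans (norm_le_enorm x); exact: ltW.
Qed.

Lemma enorm_cvg (I : Type) (F : set_system I) {FF : Filter F}
    (u : I -> 'rV[R]_n) x :
  u z @[z --> F] --> x -> enorm (u z) @[z --> F] --> enorm x.
Proof. by move=> ux; apply: (continuous_cvg _ (@enorm_continuous R n x)). Qed.

Lemma to_unit_sphere_cvg (I : Type) (F : set_system I) {FF : Filter F}
    (u : I -> 'rV[R]_n) x :
  u z @[z --> F] --> x -> to_unit_sphere (u z) @[z --> F] --> to_unit_sphere x.
Proof.
move=> ux; apply: cvgZ => //; apply: cvgV; first by rewrite gt_eqF// lt_max r_gt0 orbT.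
by apply: cvg_maxr; [exact: enorm_cvg|exact: cvg_cst].
Qed.

Lemma to_unit_sphere_continuous : continuous to_unit_sphere.
Proof. by move=> x; apply: (@to_unit_sphere_cvg _ (nbhs x) _ id); exact: cvg_id. Qed.

Lemma to_unit_sphere_fundamental :
  fundamental_sequence C (@unit_sphere R n) (fun=> to_unit_sphere).
Proof.
split=> [_|V SV]; first exact: to_unit_sphere_continuous.
exists (to_unit_sphere @^-1` V).
  move=> x [_ nAx]; have rx : r < `|x| by rewrite -(flow0 f_flow x) norm_flow_gt.
  have : nbhs (to_unit_sphere x) V.
    by apply: SV; rewrite to_unit_sphereE//; apply/normalize_sphere/(norm_gt0_neq0 _ rx)/ltW.
  exact: to_unit_sphere_continuous.
apply: nearW => k; apply: (@homotopic_in_intro _ _ _ _ (fun p => to_unit_sphere p.1)).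
- by move=> p _ _; apply: (@to_unit_sphere_cvg _ (nbhs p) _ fst); exact: cvg_fst.
- by move=> x t Vx _.
- by move=> x _.
- by move=> x _.
Qed.

Variable b : R.
Hypothesis b_gt0 : 0 < b.
Hypothesis Gb : forall x, G x -> 2 * `|x| < b.

(* On the unit sphere the sup norm is at least 1 / n, so this truncation is
   inactive near it. *)
Let c : R := 1 / (2 * n%:R).

Definition push_sphere k x := f ((b / Num.max `|x| c) *: x) k%:R.

Let c_gt0 : 0 < c.
Proof. by rewrite divr_gt0// mulr_gt0// ltr0n. Qed.

Lemma unit_sphere_norm_gt x : unit_sphere x -> c < `|x|.
Proof.
move=> /unit_sphere_norm; apply: lt_le_trans.
by rewrite /c !div1r invfM mulrC gtr_pMr ?invr_gt0 ?ltr0n// invf_lt1// ltr1n.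
Qed.

Lemma push_sphereE k x : c < `|x| -> push_sphere k x = f (to_sphere b x) k%:R.
Proof. by move=> cx; rewrite /push_sphere max_l// ltW. Qed.

Lemma push_sphere_continuous k : continuous (push_sphere k).
Proof.
move=> x; apply: (@flow_cvg _ _ _ f_flow _ (nbhs x) _
  (fun y => (b / Num.max `|y| c) *: y) (fun=> k%:R)); last exact: cvg_cst.
apply: (@cvgZ _ _ _ (nbhs x) _ (fun y => b / Num.max `|y| c) id); last exact: cvg_id.
apply: cvgM; first exact: cvg_cst.
apply: cvgV; first by rewrite gt_eqF// lt_max c_gt0 orbT.
apply: cvg_maxr; last exact: cvg_cst.
by apply: (@cvg_norm _ _ _ (nbhs x) _ id); exact: cvg_id.
Qed.

Lemma basin_norm_lt x : A x -> 2 * `|x| < b.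
Proof. by move=> Ax; apply: Gb; exact: basin_sub_bounded_orbits Ax. Qed.

Lemma norm_eq_out x : `|x| = b -> ~ A x.
Proof. by move=> xb /basin_norm_lt; rewrite xb; have := b_gt0; lra. Qed.

Lemma to_sphere_out x : x != 0 -> ~ A (to_sphere b x).
Proof. by move=> x0; apply: norm_eq_out; rewrite to_sphere_norm// ltW. Qed.

Lemma push_sphere_fundamental :
  fundamental_sequence (@unit_sphere R n) C push_sphere.
Proof.
split=> [|V CV]; first exact: push_sphere_continuous.
have [||s s0 Hs] := dual_repeller_attract f_flow f_diss f_traps isoK
    (Q := [set x | `|x| = b]) _ _ CV.
- by apply/bounded_setP; exists b => x /= ->.
- by move=> x; exact: norm_eq_out.
have oU : open [set x : 'rV[R]_n | c < `|x|].
  by apply: (@open_norm_gt _ _ _ id) => ?; exact: cvg_id.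
exists [set x : 'rV[R]_n | c < `|x|].
  by apply: open_set_nbhs => // x; exact: unit_sphere_norm_gt.
near=> k.
apply: (@homotopic_in_intro _ _ _ _ (fun p => f (to_sphere b p.1) (k%:R + p.2))) => /=.
- move=> p /= cp _; apply: (@flow_cvg _ _ _ f_flow _ (nbhs p) _
    (fun q => to_sphere b q.1) (fun q => k%:R + q.2)).
    by apply: (@to_sphere_cvg _ _ _ (nbhs p) _ fst);
      [exact: norm_gt0_neq0 (ltW c_gt0) cp|exact: cvg_fst].
  by apply: cvgD; [exact: cvg_cst|exact: cvg_snd].
- move=> x t cx /andP[t0 _]; apply: Hs.
    by rewrite /= to_sphere_norm ?(ltW b_gt0)//; exact: norm_gt0_neq0 (ltW c_gt0) cx.
  by rewrite (@le_trans _ _ k%:R)// ?lerDl//; near: k; exact: nbhs_infty_ger.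
- by move=> x cx; rewrite addr0 push_sphereE.
- by move=> x cx; rewrite natr1 push_sphereE.
Unshelve. all: by end_near. Qed.

Lemma normalize_cvg (I : Type) (F : set_system I) {FF : Filter F}
    (u : I -> 'rV[R]_n) x :
  x != 0 -> u z @[z --> F] --> x -> normalize (u z) @[z --> F] --> normalize x.
Proof.
move=> x0 ux; apply: cvgZ => //; apply: cvgV; first by rewrite gt_eqF// enorm_gt0.
exact: enorm_cvg.
Qed.

(** Pulling the flow back to time [0] deforms the composite to [normalize],
    and a straight-line homotopy, constant on the sphere, deforms [normalize] to
    the identity. *)
Lemma to_unit_sphere_push_sphere :
  fundamental_homotopic (@unit_sphere R n) (@unit_sphere R n)
    (fun k => to_unit_sphere \o push_sphere k) (fun=> id).
Proof.
move=> V SV.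
pose H (p : 'rV[R]_n * R) := (1 - p.2) *: normalize p.1 + p.2 *: p.1.
have cH p : p.1 != 0 -> {for p, continuous H}.
  move=> p0; apply: cvgD; apply: cvgZ.
  - by apply: cvgB; [exact: cvg_cst|exact: cvg_snd].
  - by apply: (@normalize_cvg _ (nbhs p) _ fst) => //; exact: cvg_fst.
  - exact: cvg_snd.
  - exact: cvg_fst.
exists [set y : 'rV[R]_n | c < `|y| /\ forall t, 0 <= t <= 1 -> V (H (y, t))].
  move=> x Sx; have cx := unit_sphere_norm_gt Sx.
  have x0 : x != 0 by exact: norm_gt0_neq0 (ltW c_gt0) cx.
  have oU : open [set y : 'rV[R]_n | c < `|y|].
    by apply: (@open_norm_gt _ _ _ id) => ?; exact: cvg_id.
  apply: filterI; first exact: (open_nbhs_nbhs (conj oU cx)).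
  have : \forall y \near x, `[0, 1] `<=` (fun t => V (H (y, t))).
    apply: ((compact_near_coveringP _).1 (@segment_compact R 0 1) _ (nbhs x)
      (fun y t => V (H (y, t)))) => t _.
    have : nbhs (H (x, t)) V.
      rewrite /H /= (_ : normalize x = x); first by rewrite -scalerDl subrK scale1r; exact: SV.
      by rewrite /normalize Sx invr1 scale1r.
    move=> /(cH (x, t) x0); rewrite /= => -[[P Q] /= [xP tQ] PQ].
    by exists (Q, P) => //= -[u y] /= [Qu Py]; exact: (PQ (y, u)).
  by apply: filterS => y yV t t01; apply: yV; rewrite /= in_itv.
apply: nearW => k; apply: (@homotopic_in_trans _ _ _ _ _ normalize).
- apply: (@homotopic_in_intro _ _ _ _
    (fun p => to_unit_sphere (f (to_sphere b p.1) ((1 - p.2) * k%:R)))).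
  + move=> p [cp _] _; have p0 := norm_gt0_neq0 (ltW c_gt0) cp.
    apply: (@to_unit_sphere_cvg _ (nbhs p) _
      (fun q => f (to_sphere b q.1) ((1 - q.2) * k%:R))).
    apply: (@flow_cvg _ _ _ f_flow _ (nbhs p) _
      (fun q => to_sphere b q.1) (fun q => (1 - q.2) * k%:R)).
      by apply: (@to_sphere_cvg _ _ _ (nbhs p) _ fst) => //; exact: cvg_fst.
    apply: cvgM; last exact: cvg_cst.
    by apply: cvgB; [exact: cvg_cst|exact: cvg_snd].
  + move=> x t [cx _] _; have x0 := norm_gt0_neq0 (ltW c_gt0) cx.
    have rx : r < `|f (to_sphere b x) ((1 - t) * k%:R)| by apply/norm_flow_gt/to_sphere_out.
    rewrite to_unit_sphereE//.
    exact/(nbhs_singleton (SV _ _))/normalize_sphere/(norm_gt0_neq0 (ltW r_gt0) rx).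
  + by move=> x [cx _]; rewrite subr0 mul1r /= push_sphereE.
  + move=> x [cx _]; have x0 := norm_gt0_neq0 (ltW c_gt0) cx.
    rewrite subrr mul0r flow0//.
    rewrite to_unit_sphereE ?normalizeZ ?divr_gt0 ?normr_gt0//.
    by rewrite -(flow0 f_flow (to_sphere b x)); apply/norm_flow_gt/to_sphere_out.
- apply: (@homotopic_in_intro _ _ _ _ H).
  + by move=> p [cp _] _; apply: cH; exact: norm_gt0_neq0 (ltW c_gt0) cp.
  + by move=> x t [_ xV]; exact: xV.
  + by move=> x _; rewrite /H /= subr0 scale1r scale0r addr0.
  + by move=> x _; rewrite /H /= subrr scale0r add0r scale1r.
Qed.

Lemma bounded_orbits_norm_lt x t : G x -> `|f x t| < b.
Proof.
move=> Gx; have := Gb (bounded_orbits_invariant f_flow t Gx).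
by have := normr_ge0 (f x t); lra.
Qed.

(** * Retraction onto a shell around the dual repeller *)

(** The shell is the image of the ball of radius [b] under the flow at time
    [k1], minus the image of the open ball of radius [r] at time [- k2].  The
    maps [squeeze] and [hollow] are the radial retractions of these two balls,
    conjugated by the flow; the second one is singular at [core k2]. *)
Section retraction.
Variables (k1 k2 : R).

Definition core t := f 0 (- t).
Definition squeeze y := f (pull_in b (f y (- k1))) k1.
Definition hollow y := f (push_out r (f y k2)) (- k2).
Definition to_shell y := hollow (squeeze y).

Lemma basin_core t : A (core t).
Proof.
by apply/flow_basinE/(ball_sub_basin f_flow f_traps isoK); rewrite normr0 ltW.
Qed.

Lemma squeeze_norm y : `|f (squeeze y) (- k1)| <= b.
Proof. by rewrite flowK// pull_in_norm// ge_min lexx orbT. Qed.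

Lemma squeeze_id y : `|f y (- k1)| <= b -> squeeze y = y.
Proof. by move=> yb; rewrite /squeeze pull_in_id// flowNK. Qed.

(** A point moved by [squeeze] is sent to the image of the sphere of radius [b],
    which lies outside the global attractor. *)
Lemma squeeze_basin y : A (squeeze y) -> squeeze y = y.
Proof.
move=> Ay; apply: squeeze_id; rewrite leNgt; apply/negP => yb.
have /(_ (- k1)) := bounded_orbits_norm_lt _ (basin_sub_bounded_orbits f_flow A_bounded Ay).
by rewrite flowK// pull_in_norm// min_r ?ltxx// ltW.
Qed.

Lemma hollow_id y : r <= `|f y k2| -> hollow y = y.
Proof. by move=> ry; rewrite /hollow push_out_id// flowK. Qed.

Lemma squeeze_neq_core y : y <> core k2 -> f (squeeze y) k2 != 0.
Proof.
move=> yq; apply/eqP => sy0.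
have sq : squeeze y = core k2 by rewrite -(flowK f_flow (squeeze y) k2) sy0.
by apply: yq; rewrite -sq squeeze_basin// sq; exact: basin_core.
Qed.

Lemma squeeze_cvg (I : Type) (F : set_system I) {FF : Filter F}
    (u : I -> 'rV[R]_n) y :
  u z @[z --> F] --> y -> squeeze (u z) @[z --> F] --> squeeze y.
Proof.
move=> uy; apply: (flow_cvg f_flow (v := fun=> k1)); last exact: cvg_cst.
apply: pull_in_cvg => //.
by apply: (flow_cvg f_flow (v := fun=> - k1)); last exact: cvg_cst.
Qed.

Lemma to_shell_cvg (I : Type) (F : set_system I) {FF : Filter F}
    (u : I -> 'rV[R]_n) y : y <> core k2 ->
  u z @[z --> F] --> y -> to_shell (u z) @[z --> F] --> to_shell y.
Proof.
move=> yq uy; apply: (flow_cvg f_flow (v := fun=> - k2)); last exact: cvg_cst.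
apply: push_out_cvg; first exact: squeeze_neq_core.
apply: (flow_cvg f_flow (v := fun=> k2)); last exact: cvg_cst.
exact: squeeze_cvg.
Qed.

Lemma to_shell_id y :
  `|f y (- k1)| <= b -> r <= `|f y k2| -> to_shell y = y.
Proof. by move=> yb ry; rewrite /to_shell squeeze_id// hollow_id. Qed.

Lemma squeeze_out y : ~ A y -> ~ A (squeeze y).
Proof. by move=> nAy As; apply: nAy; rewrite -(squeeze_basin As). Qed.

Lemma to_shell_out y : ~ A y -> to_shell y = squeeze y.
Proof.
by move=> nAy; apply/hollow_id/ltW/norm_flow_gt; exact: squeeze_out.
Qed.

Lemma to_shellP y : y <> core k2 ->
  `|f (to_shell y) (- k1)| <= b /\ r <= `|f (to_shell y) k2|.
Proof.
move=> /squeeze_neq_core y0; have [ry|yr] := leP r `|f (squeeze y) k2|.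
  by rewrite /to_shell hollow_id//; split => //; exact: squeeze_norm.
have E : `|f (to_shell y) k2| = r.
  by rewrite flowNK// push_out_norm// max_r// ltW.
split; last by rewrite E.
apply/ltW/bounded_orbits_norm_lt/(basin_sub_bounded_orbits f_flow A_bounded).
apply/(flow_basinE _ k2)/(ball_sub_basin f_flow f_traps isoK).
by rewrite E.
Qed.

Variables (U V : set 'rV[R]_n) (j : nat).
Hypothesis k2_ge0 : 0 <= k2.
Hypothesis shellV :
  forall w, `|f w (- k1)| <= b -> r <= `|f w k2| -> V w.
Hypothesis UP : forall x, U x ->
  [/\ r < `|x|, `|f x (- k1)| < b, r < `|f x k2| &
      forall t, 0 <= t <= k2 -> x <> core t].
Hypothesis j_late : forall x, `|x| <= b -> `|f x (j%:R - k1)| < b.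

Lemma core_norm t : 2 * `|core t| < b.
Proof. exact/basin_norm_lt/basin_core. Qed.

Lemma core_to_sphere_neq t x : x <> core t ->
  core t + to_sphere b (x - core t) <> core k2.
Proof.
move=> xt E; have : to_sphere b (x - core t) = core k2 - core t.
  by rewrite -E [core t + _]addrC addrK.
move=> /(congr1 (fun z => `|z|)).
rewrite to_sphere_norm ?(ltW b_gt0) ?subr_eq0//; last exact/eqP.
move=> bE; have := ler_normB (core k2) (core t); rewrite -bE.
by have := core_norm k2; have := core_norm t; lra.
Qed.

Lemma core_cvg (I : Type) (F : set_system I) {FF : Filter F} (v : I -> R) t :
  v z @[z --> F] --> t -> core (v z) @[z --> F] --> core t.
Proof.
move=> vt; apply: (flow_cvg f_flow (u := fun=> 0)); first exact: cvg_cst.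
exact: cvgN.
Qed.

(** Points of the large sphere and their orbits lie outside the basin, where
    [to_shell] is continuous and reduces to [squeeze]; applying it to the flow
    from time [j] back to time [0] stays in the shell, and it fixes the final
    position as [j] is large. *)
Lemma homotopic_late_sphere :
  homotopic_in U V (fun x => f (to_sphere b x) j%:R) (fun x => to_shell (to_sphere b x)).
Proof.
have Ux0 x : U x -> x != 0 by move=> /UP[rx _ _ _]; exact: norm_gt0_neq0 (ltW r_gt0) rx.
apply: (@homotopic_in_intro _ _ _ _
  (fun p => squeeze (f (to_sphere b p.1) ((1 - p.2) * j%:R)))).
- move=> p /Ux0 p0 _.
  apply: (@squeeze_cvg _ (nbhs p) _ (fun q => f (to_sphere b q.1) ((1 - q.2) * j%:R))).
  apply: (@flow_cvg _ _ _ f_flow _ (nbhs p) _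
    (fun q => to_sphere b q.1) (fun q => (1 - q.2) * j%:R)).
    by apply: (@to_sphere_cvg _ _ _ (nbhs p) _ fst) => //; exact: cvg_fst.
  apply: cvgM; last exact: cvg_cst.
  by apply: cvgB; [exact: cvg_cst|exact: cvg_snd].
- move=> x t /Ux0 x0 _; apply: shellV; first exact: squeeze_norm.
  by apply/ltW/norm_flow_gt/squeeze_out; rewrite flow_basinE; exact: to_sphere_out.
- move=> x /Ux0 x0; rewrite /= subr0 mul1r squeeze_id// flowD//.
  by apply/ltW/j_late; rewrite to_sphere_norm// ltW.
- move=> x /Ux0 x0; rewrite /= subrr mul0r flow0// to_shell_out//.
  exact: to_sphere_out.
Qed.

(** The centre of the radial projection travels from the origin to [core k2]
    inside the basin.  The basin has radius less than [b / 2], so the sphere of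
    radius [b] around a point of the path never meets [core k2]. *)
Lemma homotopic_moving_core :
  homotopic_in U V (fun x => to_shell (to_sphere b x))
    (fun x => to_shell (core k2 + to_sphere b (x - core k2))).
Proof.
have Uq x t : U x -> 0 <= t <= 1 -> x <> core (t * k2).
  move=> /UP[_ _ _ xq] /andP[t0 t1]; apply: xq.
  by rewrite mulr_ge0//= ler_piMl.
apply: (@homotopic_in_intro _ _ _ _
  (fun p => to_shell (core (p.2 * k2) + to_sphere b (p.1 - core (p.2 * k2))))).
- move=> p Up /(Uq _ _ Up) pq.
  have cq : core (q.2 * k2) @[q --> p] --> core (p.2 * k2).
    apply: (@core_cvg _ (nbhs p) _ (fun q => q.2 * k2)).
    by apply: cvgM; [exact: cvg_snd|exact: cvg_cst].
  apply: (@to_shell_cvg _ (nbhs p) _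
    (fun q => core (q.2 * k2) + to_sphere b (q.1 - core (q.2 * k2)))).
    exact: core_to_sphere_neq.
  apply: cvgD => //.
  apply: (@to_sphere_cvg _ _ _ (nbhs p) _ (fun q => q.1 - core (q.2 * k2))).
    by rewrite subr_eq0; apply/eqP.
  by apply: cvgB => //; exact: cvg_fst.
- move=> x t Ux /(Uq _ _ Ux) xq.
  by have [? ?] := to_shellP (core_to_sphere_neq xq); exact: shellV.
- move=> x _; rewrite /= mul0r.
  by rewrite (_ : core 0 = 0) ?add0r ?subr0// /core oppr0 flow0.
- by move=> x _; rewrite /= mul1r.
Qed.

(** Each point slides along the ray that issues from [core k2]. *)
Lemma homotopic_sliding :
  homotopic_in U V (fun x => to_shell (core k2 + to_sphere b (x - core k2))) id.
Proof.
have Uq x : U x -> x <> core k2.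
  by move=> /UP[_ _ _]; apply; rewrite k2_ge0 lexx.
pose a (p : 'rV[R]_n * R) := p.2 + (1 - p.2) * (b / `|p.1 - core k2|).
have a_gt0 x t : U x -> 0 <= t <= 1 -> 0 < a (x, t).
  move=> /Uq/eqP; rewrite -subr_eq0 -normr_gt0 /a /= => xq /andP[t0 t1].
  have : 0 < b / `|x - core k2| by rewrite divr_gt0.
  have [->|t_neq0] := eqVneq t 0; first by rewrite subr0 mul1r add0r.
  have t_gt0 : 0 < t by rewrite lt_neqAle eq_sym t_neq0.
  by move=> /ltW b0; rewrite ltr_pwDl// mulr_ge0// subr_ge0.
have aq x t : U x -> 0 <= t <= 1 -> core k2 + a (x, t) *: (x - core k2) <> core k2.
  move=> Ux t01 /(congr1 (fun z => z - core k2)); rewrite [core k2 + _]addrC addrK subrr.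
  move/eqP; rewrite scaler_eq0 gt_eqF ?a_gt0//= subr_eq0 => /eqP.
  exact: Uq.
apply: (@homotopic_in_intro _ _ _ _
  (fun p => to_shell (core k2 + a p *: (p.1 - core k2)))).
- move=> [x t] Ux t01.
  apply: (@to_shell_cvg _ (nbhs (x, t)) _ (fun q => core k2 + a q *: (q.1 - core k2))).
    exact: aq.
  have c1 : q.1 - core k2 @[q --> (x, t)] --> x - core k2.
    by apply: cvgB; [exact: cvg_fst|exact: cvg_cst].
  apply: cvgD; first exact: cvg_cst.
  apply: (@cvgZ _ _ _ (nbhs (x, t)) _ a) => //.
  have c2 : q.2 @[q --> (x, t)] --> t by exact: cvg_snd.
  apply: cvgD => //; apply: cvgM; first by apply: cvgB => //; exact: cvg_cst.
  apply: cvgM; first exact: cvg_cst.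
  apply: cvgV; last exact: cvg_norm.
  by rewrite normr_eq0 subr_eq0; apply/eqP/Uq.
- by move=> x t Ux t01; have [? ?] := to_shellP (aq _ _ Ux t01); exact: shellV.
- by move=> x _; rewrite /a /= subr0 mul1r add0r.
- move=> x Ux; rewrite /a /= subrr mul0r addr0 scale1r [core k2 + _]addrC subrK.
  by have [_ xb rx _] := UP Ux; apply: to_shell_id; exact: ltW.
Qed.

End retraction.

(** The times [k1] and [k2] are chosen by compactness so that the shell lies in
    the given neighbourhood [V]: first [k1] brings the large ball into [V]
    together with the basin, then [k2] sends the part outside [V], a compact
    subset of the basin, into the trapped ball. *)
Lemma push_sphere_to_unit_sphere :
  fundamental_homotopic C C (fun k => push_sphere k \o to_unit_sphere) (fun=> id).
Proof.
move=> V /set_nbhsP[V' [oV' CV' V'V]].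
have oA : open A by exact: basin_open f_traps isoK.
have oVA : open (V' `|` A) by exact: openU.
have GVA : G `<=` V' `|` A.
  by move=> x Gx; have [|nAx] := pselect (A x); [right|left; apply: CV'].
have [k1 k1_gt0 Hk1] := bounded_orbits_attract_ball f_flow f_diss b oVA GVA.
pose Z := [set f z k1 | z in [set z : 'rV[R]_n | `|z| <= b]] `&` ~` V'.
have cZ : compact Z.
  apply: compact_closedI; last exact: open_closedC.
  apply: continuous_compact; last exact: norm_le_compact.
  by apply: continuous_subspaceT; exact: flow_continuousl.
have ZA : Z `<=` A.
  by move=> _ [[z zb <-] nV]; have [] := Hk1 z k1 zb (lexx _).
have [k2 [k2_ge0 Zk2]] := basin_compact_trapped cZ ZA.
have shellV w : `|f w (- k1)| <= b -> r <= `|f w k2| -> V w.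
  move=> wb rw; apply: V'V; apply: contrapT => nV.
  have /Zk2 : Z w by split => //; exists (f w (- k1)) => //; exact: flowNK.
  by rewrite ltNge rw.
pose path := [set core t | t in `[0, k2]].
have cpath : closed path.
  apply: rV_compact_closed; apply: continuous_compact; last exact: segment_compact.
  by apply: continuous_subspaceT => t; apply: (@core_cvg _ (nbhs t) _ id); exact: cvg_id.
pose U := [set x : 'rV[R]_n | r < `|x|] `&` [set x | `|f x (- k1)| < b] `&`
  [set x | r < `|f x k2|] `&` ~` path.
have oU : open U.
  apply: openI; last exact: closed_openC.
  apply: openI; last by apply: open_norm_gt; exact: flow_continuousl.
  apply: openI; last by apply: open_norm_lt; exact: flow_continuousl.
  by apply: (@open_norm_gt _ _ _ id) => ?; exact: cvg_id.
have CU : C `<=` U.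
  move=> x [Gx nAx]; split; [split; [split|]|] => /=.
  - by rewrite -(flow0 f_flow x); exact: norm_flow_gt.
  - exact: bounded_orbits_norm_lt.
  - exact: norm_flow_gt.
  - by move=> [t _ tx]; apply: nAx; rewrite -tx; exact: basin_core.
have UP x : U x -> [/\ r < `|x|, `|f x (- k1)| < b, r < `|f x k2| &
      forall t, 0 <= t <= k2 -> x <> core t].
  move=> [[[? ?] ?] xp]; split => // t tk xt; apply: xp.
  by exists t => //; rewrite /= in_itv.
exists U; first exact: open_set_nbhs.
have oB : open [set x : 'rV[R]_n | `|x| < b].
  by apply: (@open_norm_lt _ _ _ id) => ?; exact: cvg_id.
have GB : G `<=` [set x : 'rV[R]_n | `|x| < b].
  by move=> x Gx /=; rewrite -(flow0 f_flow x) bounded_orbits_norm_lt.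
have [s s_gt0 Hs] := bounded_orbits_attract_ball f_flow f_diss b oB GB.
near=> j.
have j_late x : `|x| <= b -> `|f x (j%:R - k1)| < b.
  move=> xb; apply: Hs => //; rewrite lerBrDr.
  by near: j; exact: nbhs_infty_ger.
have late := homotopic_late_sphere shellV UP j_late.
have mov := homotopic_moving_core k2_ge0 shellV UP.
have sli := homotopic_sliding k2_ge0 shellV UP.
have [H [cH H0 H1 HV]] := homotopic_in_trans late (homotopic_in_trans mov sli).
exists H; split => // x Ux; rewrite H0//=.
have [rx _ _ _] := UP _ Ux.
have x0 : x != 0 by exact: norm_gt0_neq0 (ltW r_gt0) rx.
rewrite to_unit_sphereE// push_sphereE; last exact/unit_sphere_norm_gt/normalize_sphere.
by rewrite to_sphereZ// invr_gt0 enorm_gt0.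
Unshelve. all: by end_near. Qed.

Lemma dual_repeller_shape : same_shape C (@unit_sphere R n).
Proof.
exists (fun=> to_unit_sphere), push_sphere; split.
- exact: to_unit_sphere_fundamental.
- exact: push_sphere_fundamental.
- exact: push_sphere_to_unit_sphere.
- exact: to_unit_sphere_push_sphere.
Qed.

End shape.

(** * Families of flows *)

(** Every time later than [T] is a sum of times in [[T, 2 T]]. *)
Lemma traps_ball_window (R : realType) (n : nat) (f : 'rV[R]_n -> R -> 'rV[R]_n)
    (r T : R) :
  is_flow f -> 0 < T ->
  (forall x t, `|x| <= r -> T <= t <= 2 * T -> `|f x t| < r) -> traps_ball f r T.
Proof.
move=> f_flow T0 window x t xr Tt.
have [k tk] : exists k : nat, t <= T + k%:R * T.
  exists (Num.trunc (t / T)).+1; have := ltW (truncnS_gt (t / T)).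
  by rewrite ler_pdivrMr// => /le_trans; apply; rewrite lerDr ltW.
elim: k x t xr Tt tk => [|k IH] x t xr Tt tk.
  by apply: window => //; rewrite Tt (le_trans tk)// mul0r addr0 mulr_natl mulr2n lerDl ltW.
have [t2|t2] := leP t (2 * T); first by apply: window => //; rewrite Tt.
rewrite (_ : t = T + (t - T)); last by rewrite addrC subrK.
rewrite -(flowD f_flow); apply: IH.
- by apply/ltW/window => //; rewrite lexx mulr_natl mulr2n lerDl ltW.
- by move: t2; lra.
- by move: tk; rewrite -natr1 mulrDl; lra.
Qed.

Lemma parameter_interval_unit (R : realType) (J : set R) :
  parameter_interval J -> forall l, J l -> 0 <= l <= 1.
Proof.
move=> [a [b [a0 ab b1 ->]]] l /= /andP[al lb].
by rewrite (le_trans a0 al) (le_trans lb b1).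
Qed.

Section families.
Variables (R : realType) (n : nat) (phi : R -> 'rV[R]_n -> R -> 'rV[R]_n).
Hypothesis phi_diss : dissipative_family phi.
Implicit Types (J : set R) (K C : R -> set 'rV[R]_n).

Lemma family_flow l : 0 <= l <= 1 -> is_flow (phi l).
Proof. by move=> l01; have [[_ +] _] := phi_diss; exact. Qed.

Lemma family_dissipative l : 0 <= l <= 1 -> dissipative (phi l).
Proof. by move=> l01; have [_ +] := phi_diss; exact. Qed.

Let unit0 : 0 <= (0 : R) <= 1.
Proof. by rewrite lexx ler01. Qed.

Lemma family_window (Q : set ('rV[R]_n * R)) (V : set 'rV[R]_n) :
  compact Q -> open V -> (forall p, Q p -> V (phi 0 p.1 p.2)) ->
  exists2 d, 0 < d &
    forall l p, 0 <= l <= 1 -> l < d -> Q p -> V (phi l p.1 p.2).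
Proof.
move=> cQ oV QV.
have [[/subspace_continuousP phi_cont _] _] := phi_diss.
have : \forall l \near within [set l : R | 0 <= l <= 1] (nbhs 0),
    Q `<=` (fun p => V (phi l p.1 p.2)).
  apply: ((compact_near_coveringP _).1 cQ _ (within [set l : R | 0 <= l <= 1] (nbhs 0))
    (fun l p => V (phi l p.1 p.2))) => p Qp.
  have := phi_cont (p, 0) unit0 V (open_nbhs_nbhs (conj oV (QV _ Qp))).
  rewrite /= /within /= => -[[P L] /= [pP L0] PL].
  exists (P, [set l | 0 <= l <= 1 /\ L l]) => /=.
    by split => //; apply: filterS L0 => l Ll l01; split.
  by move=> [q l] /= [Pq [l01 Ll]]; exact: (PL (q, l)).
rewrite /within /= => /nbhs_ballP[d /= d0 Hd]; exists d => // l p l01 ld Qp.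
apply: Hd => //; rewrite /ball /= sub0r normrN ger0_norm//.
by have /andP[] := l01.
Qed.

(** The continuation property transfers isolation to nearby parameters, and
    continuity in the parameter transfers trapping, which only has to be checked
    on a compact time window. *)
Lemma continuation_traps J K (r : R) :
  attractor_continuation phi J K -> (forall x, bounded_orbits (phi 0) x -> `|x| < r) ->
  exists T d, 0 < d /\ forall l, J l -> l < d ->
    traps_ball (phi l) r T /\ isolating_nbhd (phi l) (K l) [set x : 'rV[R]_n | `|x| <= r].
Proof.
move=> [[intJ isoK contK] J0 glob] Gr.
have f0 := family_flow unit0; have d0 := family_dissipative unit0.
have K0 := global_attractor_bounded_orbits f0 glob.
have oV : open [set x : 'rV[R]_n | `|x| < r].
  by apply: (@open_norm_lt _ _ _ id) => ?; exact: cvg_id.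
have iso0 : isolating_nbhd (phi 0) (K 0) [set x : 'rV[R]_n | `|x| <= r].
  split.
  - exact: norm_le_compact.
  - apply/set_nbhsP; exists [set x : 'rV[R]_n | `|x| < r]; split => //.
      by move=> x; rewrite K0 => /Gr.
    by move=> x /ltW.
  - by have [_ + _] := isoK 0 J0.
  - move=> L iL Lr; rewrite K0; apply: (bounded_invariant_sub iL).
    by apply/bounded_setP; exists r.
have [d1 d1_gt0 Hd1] := contK 0 _ J0 iso0.
have [T T0 HT] := bounded_orbits_attract_ball f0 d0 r oV Gr.
pose Q := [set x : 'rV[R]_n | `|x| <= r] `*` `[T, 2 * T].
have cQ : compact Q by apply: compact_setX; [exact: norm_le_compact|exact: segment_compact].
have [|d2 d2_gt0 Hd2] := family_window cQ oV.
  move=> [x t] [/= xr]; rewrite in_itv /= => /andP[Tt _]; exact: HT.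
exists T, (Num.min d1 d2); split; first by rewrite lt_min d1_gt0.
move=> l Jl; rewrite lt_min => /andP[ld1 ld2].
have l01 := parameter_interval_unit intJ Jl; have /andP[l0 _] := l01.
split; last by apply: Hd1 => //; rewrite !add0r ld1 andbT; move: d1_gt0; lra.
apply: traps_ball_window => //; first exact: family_flow.
by move=> x t xr tT; apply: (Hd2 l (x, t)) => //; split => //=; rewrite in_itv.
Qed.

(** One radius [r0] provides the compacta; the larger radii, valid for smaller
    parameters, make their diameters tend to infinity. *)
Lemma coercive_separating_family J K : (1 < n)%N ->
  attractor_continuation phi J K -> coercive phi ->
  exists l0 : R, 0 < l0 /\ exists C, separating_family phi J K C l0.
Proof.
move=> n1 hK /(_ J K hK)[l1 l1_gt0 Hl1].
have [[intJ _ _] J0 _] := hK.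
have [M HM] := bounded_orbits_bounded (family_flow unit0) (family_dissipative unit0).
pose r0 := Num.max M 0 + 1.
have Gr0 r : r0 <= r -> forall x, bounded_orbits (phi 0) x -> `|x| < r.
  move=> r0r x /HM xM; apply: lt_le_trans r0r; apply: (le_lt_trans xM).
  by rewrite ltr_pwDr// le_max lexx.
have r0_gt0 : 0 < r0 by rewrite ltr_wpDl// le_max lexx orbT.
have [T [d [d_gt0 Hd]]] := continuation_traps hK (Gr0 r0 (lexx _)).
exists (Num.min l1 d); split; first by rewrite lt_min l1_gt0.
exists (fun l => dual_repeller (phi l) (K l)); split.
  move=> l /andP[l_gt0]; rewrite lt_min => /andP[ll1 ld].
  have [|Jl bA] := Hl1 l; first by rewrite l_gt0.
  have [tr iso] := Hd l Jl ld.
  have l01 := parameter_interval_unit intJ Jl.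
  have fl := family_flow l01; have dl := family_dissipative l01.
  have n0 : (0 < n)%N by exact: ltnW.
  split=> //; split.
  - exact: dual_repeller_isolated tr iso.
  - by move=> x [_ nAx] /(isolated_sub_basin fl tr iso).
  - have [M' HM'] := bounded_orbits_bounded fl dl.
    have b_gt0 : 0 < 2 * Num.max M' 0 + 1.
      by rewrite ltr_wpDl// mulr_ge0// le_max lexx orbT.
    apply: (dual_repeller_shape n0 fl dl r0_gt0 tr iso bA b_gt0) => x /HM' xM'.
    by rewrite ltr_pwDr// ler_pM2l// le_max xM'.
  - exists (region_of_attraction (phi l) (K l)), (~` bounded_orbits (phi l)); split.
    + exact: dual_repeller_separates tr iso bA n1.
    + exact: isolated_sub_basin tr iso.
    + by move=> x nGx; exact: dual_repeller_attracts_uniformly tr iso bA _ nGx.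
    + by move=> x Ax nKx; exact: dual_repeller_repels tr iso bA _ Ax nKx.
apply/cvgeyPge => A; pose r := Num.max A r0.
have r_ge : r0 <= r by rewrite le_max lexx orbT.
have [T' [d' [d'_gt0 Hd']]] := continuation_traps hK (Gr0 r r_ge).
near=> l; have l_gt0 : 0 < l by near: l; exact: nbhs_right_gt.
have [|Jl bA] := Hl1 l; first by rewrite l_gt0 /=; near: l; exact: nbhs_right_lt.
have [|tr iso] := Hd' l Jl; first by near: l; exact: nbhs_right_lt.
have l01 := parameter_interval_unit intJ Jl.
apply: (@le_trans _ _ r%:E); first by rewrite lee_fin le_max lexx.
have r_gt0 : 0 < r by exact: lt_le_trans r_ge.
have rd := dual_repeller_diam (family_flow l01) (family_dissipative l01) r_gt0 tr iso bA.
exact: rd (ltnW n1).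
Unshelve. all: by end_near. Qed.

(** The points of the unbounded component and those of [C] have their omega-limit
    in [C], which misses [L]; so the basin of [L] stays in the bounded
    component. *)
Lemma separating_compactum_basin_bounded (f : 'rV[R]_n -> R -> 'rV[R]_n)
    (L C : set 'rV[R]_n) :
  separating_compactum f L C -> bounded_set (region_of_attraction f L).
Proof.
move=> [[cC iC _] CL _ [B [W [[comp bB _] _ Wattr _]]]].
have clC := rV_compact_closed cC.
have /bounded_setP[M BM] := bB; apply/bounded_setP; exists M => x [[y xy] xL].
apply: BM; apply: contrapT => nBx.
suff Cy : C y by exact: CL Cy (xL _ xy).
have [Cx|nCx] := pselect (C x).
  by apply: (@omega_limit_closed _ _ _ x C 0) xy => // t _; exact: iC.
have Wx : W x.
  have : [set B; W] (connected_component (~` C) x) by rewrite -comp; exists x.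
  have := @connected_component_refl _ (~` C) x nCx.
  by move=> /[swap] -[->//|->].
apply: contrapT => nCy.
have [e /= e0 eC] := (nbhs_ballP y (~` C)).1 (open_nbhs_nbhs (conj (closed_openC clC) nCy)).
pose V := [set z | e / 2 < `|y - z|].
have oV : open V.
  apply: open_norm_gt => z.
  by apply: (@cvgB _ _ _ (nbhs z) _ (fun=> y) id); [exact: cvg_cst|exact: cvg_id].
have CV : set_nbhs C V.
  apply: open_set_nbhs => // z Cz; rewrite /V /= ltNge; apply/negP => yz.
  apply: (eC z) => //; rewrite -ball_normE /=; apply: le_lt_trans yz _.
  by rewrite ltr_pdivrMr// ltr_pMr// ltr1n.
have [U [T [xU _ UV]]] := Wattr x Wx V CV.
have ye : nbhs y (ball y (e / 2)) by apply: nbhsx_ballx; rewrite divr_gt0.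
have [t Tt] := (omega_limitP f x y).1 xy _ ye T.
rewrite -ball_normE /= ltNge => /negP; apply; apply/ltW.
exact: UV (nbhs_singleton xU) Tt.
Qed.

(** Two continuations of the global attractor agree for small parameters, both
    being the maximal invariant set of the same neighbourhood. *)
Lemma attractor_continuation_unique J K J' K' :
  attractor_continuation phi J K -> attractor_continuation phi J' K' ->
  exists2 d : R, 0 < d & forall l, J l -> J' l -> 0 <= l < d -> K l = K' l.
Proof.
move=> [[_ isoK contK] J0 glob] [[_ _ contK'] J'0 glob'].
have f0 := family_flow unit0.
have E : K 0 = K' 0.
  rewrite (global_attractor_bounded_orbits f0 glob).
  by rewrite (global_attractor_bounded_orbits f0 glob').
have [_ _ [N isoN]] := isoK 0 J0.
have [d d0 Hd] := contK 0 N J0 isoN.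
have [|d' d'0 Hd'] := contK' 0 N J'0; first by rewrite -E.
exists (Num.min d d'); first by rewrite lt_min d0.
move=> l Jl J'l /andP[l0]; rewrite lt_min => /andP[ld ld'].
have [|_ KN iK maxK] := Hd l Jl; first by rewrite !add0r ld andbT; move: d0; lra.
have [|_ KN' iK' maxK'] := Hd' l J'l; first by rewrite !add0r ld' andbT; move: d'0; lra.
apply/seteqP; split.
  by apply: maxK' => // x Kx; exact: nbhs_singleton (KN _ Kx).
by apply: maxK => // x Kx; exact: nbhs_singleton (KN' _ Kx).
Qed.

Lemma separating_family_coercive J K C (l0 : R) :
  attractor_continuation phi J K -> 0 < l0 -> separating_family phi J K C l0 ->
  coercive phi.
Proof.
move=> hK l0_gt0 [sepC _] J' K' hK'.
have [d d0 Hd] := attractor_continuation_unique hK hK'.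
have [[intJ' _ _] J'0 _] := hK'.
have [a [b [a0 ab b1 EJ']]] := intJ'.
have J'small l : 0 < l < b -> J' l.
  move: J'0; rewrite EJ' /= => /andP[a_le0 _] /andP[l_gt0 lb].
  by rewrite (le_trans a_le0)//= ltW.
exists (Num.min b (Num.min d l0)).
  rewrite !lt_min d0 l0_gt0 !andbT; apply: le_lt_trans ab; exact: a0.
move=> l /andP[l_gt0]; rewrite !lt_min => /andP[lb /andP[ld ll0]].
have [|Jl sep] := sepC l; first by rewrite l_gt0.
have J'l : J' l by apply: J'small; rewrite l_gt0.
split => //; rewrite -Hd//; last by rewrite (ltW l_gt0).
exact: separating_compactum_basin_bounded sep.
Qed.

End families.

Theorem theorem11 (R : realType) (n : nat)
    (phi : R -> 'rV[R]_n -> R -> 'rV[R]_n)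
    (hphi : dissipative_family phi)
    (J : set R) (K : R -> set 'rV[R]_n)
    (hK : attractor_continuation phi J K) :
  ((1 < n)%N -> coercive phi ->
     exists l0 : R, 0 < l0 /\
       exists C : R -> set 'rV[R]_n, separating_family phi J K C l0) /\
  ((exists l0 : R, 0 < l0 /\
      exists C : R -> set 'rV[R]_n, separating_family phi J K C l0) ->
   coercive phi).
Proof.
split=> [n1 coer|[l0 [l0_gt0 [C sepC]]]].
  exact: coercive_separating_family.
exact: separating_family_coercive hK l0_gt0 sepC.
Qed.
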